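(* Let $(X,d,o)$ be a complete pointed $\mathrm{CAT}(-1)$-space (not assumed locally compact). Let $(R_k)_{k\in\mathbf N}$ be a sequence of representations $\mathbf F_r\to\mathrm{Isom}\,X$ and let $R_\infty:\mathbf F_r\to\mathrm{Isom}\,X$ be a Schottky representation. Assume that the orbit maps $\tau_k(g)=R_k(g)\cdot o$ converge pointwise to $\tau_\infty(g)=R_\infty(g)\cdot o$: $$\forall g\in\mathbf F_r,\quad R_k(g)\cdot o\xrightarrow[k\to\infty]{}R_\infty(g)\cdot o.$$ Then: 1. the sequence of limit sets $(\Lambda_k)_{k\in\mathbf N}$ of $(R_k)_{k\in\mathbf N}$ converges, in the Hausdorff topology of $\partial X$, to the limit set $\Lambda_\infty$ of $R_\infty$; 2. the sequence $\mathrm{Hdim}\,\Lambda_k$ converges to $\mathrm{Hdim}\,\Lambda_\infty$.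
   Context: $\mathbf F_r$ ($r\ge2$) is the free group on $r$ generators, with word length $|\cdot|$. A $\mathrm{CAT}(-1)$-space is a geodesic metric space whose geodesic triangles are at least as thin as their comparison triangles in the hyperbolic plane. The Gromov product is $\langle x,y\rangle_z=\frac12(d(x,z)+d(y,z)-d(x,y))$. The boundary $\partial X$ is the set of classes of sequences $(x_n)$ with $\langle x_n,x_m\rangle_o\to\infty$ as $n,m\to\infty$, two sequences being equivalent if $\langle x_n,y_n\rangle_o\to\infty$; the Gromov product extends continuously to $\partial X$. The boundary carries the visual metric $d_o(\xi,\zeta)=e^{-\langle\xi,\zeta\rangle_o}$; Hausdorff dimension $\mathrm{Hdim}$ and Hausdorff convergence of subsets of $\partial X$ are taken with respect to $d_o$. A representation $\rho:\mathbf F_r\to\mathrm{Isom}\,X$ is Schottky if, for some $K\ge1$, its orbit map $\tau_\rho(g)=\rho(g)\cdot o$ satisfies $\frac1K|g^{-1}h|-K\le d(\tau_\rho(g),\tau_\rho(h))\le K|g^{-1}h|+K$ for all $g,h\in\mathbf F_r$. The limit set of a representation is the set of accumulation points in $\partial X$ of the orbit of $o$; for a Schottky representation it is the image of $\partial\mathbf F_r$ under the continuous extension $\tau_\rho:\partial\mathbf F_r\to\partial X$. *)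

(* Defs.v *)
From HB Require Import structures.
From mathcomp Require Import all_boot all_order all_algebra.
From mathcomp Require Import all_classical all_reals all_analysis.
Import numFieldNormedType.Exports.

Set Implicit Arguments.
Unset Strict Implicit.
Unset Printing Implicit Defensive.

Import Order.TTheory GRing.Theory Num.Theory.

Local Open Scope classical_set_scope.
Local Open Scope ring_scope.

#[short(type="completeMetricType")]
HB.structure Definition CompleteMetric (R : numDomainType) :=
  {T of Complete T & Metric R T}.

Section letters.
Context {r : nat}.

(* [(i, false)] is the generator [x_i] and [(i, true)] is its inverse. *)
Definition letter : Type := ('I_r * bool)%type.

Definition invl (a : letter) : letter := (a.1, ~~ a.2).

Definition reduced (w : seq letter) : bool :=
  sorted (fun a b => b != invl a) w.

Definition push (a : letter) (w : seq letter) : seq letter :=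
  if w is b :: w' then if b == invl a then w' else a :: w else [:: a].

Definition reduce (w : seq letter) : seq letter := foldr push [::] w.

Definition invw (w : seq letter) : seq letter := rev (map invl w).

Lemma invlK : involutive invl.
Proof. by case=> i b; rewrite /invl /= negbK. Qed.

Lemma push_reduced a w : reduced w -> reduced (push a w).
Proof.
case: w => [|b w] //=; case: eqP => [_|/eqP ba] bw; last by rewrite /= ba.
by case: w bw => //= c w /andP[].
Qed.

Lemma foldr_push_reduced u w : reduced w -> reduced (foldr push w u).
Proof. by move=> rw; elim: u => //= a u; exact: push_reduced. Qed.

Lemma reduce_reduced w : reduced (reduce w).
Proof. exact: foldr_push_reduced. Qed.

Lemma reduce_id w : reduced w -> reduce w = w.
Proof.
elim: w => //= a w IHw rw.
rewrite IHw; last by case: w rw {IHw} => //= b w /andP[].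
by case: w rw {IHw} => //= b w /andP[/negbTE ->].
Qed.

Lemma pushK a w : reduced w -> push (invl a) (push a w) = w.
Proof.
case: w => [|b w] /=; first by rewrite invlK eqxx.
case: (eqVneq b (invl a)) => [->|ba] rw /=; last by rewrite invlK eqxx.
by case: w rw => //= c w /andP[/negbTE ->].
Qed.

Lemma foldr_push_reduce u w :
  reduced w -> foldr push w (reduce u) = foldr push w u.
Proof.
move=> rw; elim: u => //= a u <-; rewrite {1}/push.
case E: (reduce u) => [|b v] //=; case: eqP => [ba|//].
have -> : a = invl b by rewrite ba invlK.
by rewrite pushK// foldr_push_reduced.
Qed.

Lemma reduce_catl u v : reduce (reduce u ++ v) = reduce (u ++ v).
Proof.
by rewrite /reduce !foldr_cat; apply/foldr_push_reduce/reduce_reduced.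
Qed.

Lemma reduce_catr u v : reduce (u ++ reduce v) = reduce (u ++ v).
Proof. by rewrite /reduce !foldr_cat -!/(reduce _) reduce_id// reduce_reduced. Qed.

Lemma invwK : involutive invw.
Proof. by move=> w; rewrite /invw map_rev revK (mapK invlK). Qed.

Lemma invw_reduced w : reduced w -> reduced (invw w).
Proof.
rewrite /invw /reduced rev_sorted sorted_map.
apply: (sub_sorted (e := fun a b => b != invl a)) => a b /=.
by apply: contraNneq => ->; rewrite !invlK.
Qed.

Lemma reduce_invw_cat w : reduce (invw w ++ w) = [::].
Proof.
suff H v : reduced v -> foldr push (foldr push v w) (invw w) = v.
  by rewrite /reduce foldr_cat H.
elim: w v => //= a w IHw v rv.
rewrite /invw /= rev_cons -cats1 foldr_cat /=.
by rewrite pushK ?IHw ?foldr_push_reduced.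
Qed.

End letters.
Arguments letter : clear implicits.

Record free_group (r : nat) :=
  FreeGroup { fg_word :> seq (letter r); fg_reduced : reduced fg_word }.

HB.instance Definition _ (r : nat) := [isSub for @fg_word r].
HB.instance Definition _ (r : nat) := [Choice of free_group r by <:].

Section free_group_law.
Context {r : nat}.
Implicit Types g h : free_group r.

Definition fg_one : free_group r := @FreeGroup r [::] isT.

Definition fg_mul g h : free_group r :=
  FreeGroup (reduce_reduced (fg_word g ++ fg_word h)).

Definition fg_inv g : free_group r := FreeGroup (invw_reduced (fg_reduced g)).

Lemma fg_mulA : associative fg_mul.
Proof. by move=> g h k; apply/val_inj; rewrite /= reduce_catl reduce_catr catA. Qed.

Lemma fg_mul1 : left_id fg_one fg_mul.
Proof. by move=> g; apply/val_inj; rewrite /= reduce_id// fg_reduced. Qed.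

Lemma fg_mulr1 : right_id fg_one fg_mul.
Proof. by move=> g; apply/val_inj; rewrite /= cats0 reduce_id// fg_reduced. Qed.

Lemma fg_mulV : left_inverse fg_one fg_inv fg_mul.
Proof. by move=> g; apply/val_inj; rewrite /= reduce_invw_cat. Qed.

Lemma fg_mulrV : right_inverse fg_one fg_inv fg_mul.
Proof.
by move=> g; apply/val_inj; rewrite /= -{1}[fg_word g]invwK reduce_invw_cat.
Qed.

HB.instance Definition _ := isGroup.Build (free_group r)
  fg_mulA fg_mul1 fg_mulr1 fg_mulV fg_mulrV.

Definition word_length g : nat := size (fg_word g).

End free_group_law.

Record Isom (R : realType) (X : metricType R) := Isometry {
  isometry_fun :> X -> X;
  isometry_mdist :
    forall x y, mdist (isometry_fun x) (isometry_fun y) = mdist x y;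
  isometry_surj : forall y, exists x, isometry_fun x = y }.

Section isometry_group.
Context {R : realType} {X : metricType R}.
Implicit Types f g : Isom X.

HB.instance Definition _ := gen_eqMixin (Isom X).
HB.instance Definition _ := gen_choiceMixin (Isom X).

Lemma isometry_ext f g : f =1 g -> f = g.
Proof.
case: f g => [f fd fs] [g gd gs] /= /funext fg; subst g.
by congr Isometry; exact: Prop_irrelevance.
Qed.

Definition isometry_one : Isom X :=
  @Isometry R X idfun (fun _ _ => erefl) (fun y => ex_intro _ y erefl).

Lemma isometry_mul_surj f g y : exists x, (f \o g) x = y.
Proof.
by have [z <-] := isometry_surj f y; have [x <-] := isometry_surj g z; exists x.
Qed.

Definition isometry_mul f g : Isom X := @Isometry R X (f \o g)
  (fun x y => etrans (isometry_mdist f _ _) (isometry_mdist g _ _))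
  (isometry_mul_surj f g).

Definition isometry_inv_fun f (y : X) : X := projT1 (cid (isometry_surj f y)).

Lemma isometry_inv_funK f : cancel (isometry_inv_fun f) f.
Proof. by move=> y; rewrite /isometry_inv_fun; case: cid. Qed.

Lemma isometry_funK f : cancel f (isometry_inv_fun f).
Proof.
move=> x; apply: (@mdist_positivity R X).
by rewrite -(isometry_mdist f) isometry_inv_funK mdistxx.
Qed.

Lemma isometry_inv_mdist f x y :
  mdist (isometry_inv_fun f x) (isometry_inv_fun f y) = mdist x y.
Proof. by rewrite -(isometry_mdist f) !isometry_inv_funK. Qed.

Definition isometry_inv f : Isom X := @Isometry R X (isometry_inv_fun f)
  (isometry_inv_mdist f) (fun y => ex_intro _ (f y) (isometry_funK f y)).

Lemma isometry_mulA : associative isometry_mul.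
Proof. by move=> f g h; exact: isometry_ext. Qed.

Lemma isometry_mul1 : left_id isometry_one isometry_mul.
Proof. by move=> f; exact: isometry_ext. Qed.

Lemma isometry_mulr1 : right_id isometry_one isometry_mul.
Proof. by move=> f; exact: isometry_ext. Qed.

Lemma isometry_mulV : left_inverse isometry_one isometry_inv isometry_mul.
Proof. by move=> f; apply: isometry_ext; exact: isometry_funK. Qed.

Lemma isometry_mulrV : right_inverse isometry_one isometry_inv isometry_mul.
Proof. by move=> f; apply: isometry_ext; exact: isometry_inv_funK. Qed.

HB.instance Definition _ := isGroup.Build (Isom X) isometry_mulA
  isometry_mul1 isometry_mulr1 isometry_mulV isometry_mulrV.

End isometry_group.

Notation representation r X :=
  {multiplicative free_group r -> Isom X} (only parsing).

(* The hyperbolic plane, in the upper half-plane model. *)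
Record hplane (R : realType) :=
  HPlane { hre : R; him : R; him_gt0 : 0 < him }.

Section hyperbolic_plane.
Context {R : realType}.

Definition arcosh (t : R) : R := ln (t + Num.sqrt (t ^+ 2 - 1)).

(* That is, [cosh (hdist z w) = 1 + |z - w|^2 / (2 Im z Im w)]. *)
Definition hdist (z w : hplane R) : R :=
  arcosh (1 + ((hre z - hre w) ^+ 2 + (him z - him w) ^+ 2)
              / (2 * him z * him w)).

End hyperbolic_plane.

Section cat.
Context {R : realType} (X : metricType R).

Definition geodesic (x y : X) (c : R -> X) : Prop :=
  [/\ c 0 = x, c (mdist x y) = y &
      {in `[0, mdist x y] &, forall s t, mdist (c s) (c t) = `|s - t|}].

Definition geodesic_space : Prop := forall x y : X, exists c, geodesic x y c.

(* A triangle has vertices [v i] and sides [c i] from [v i] to [v (ordS i)];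
   [w] is a comparison triangle, and [a], [b] are the comparison points of the
   points at parameters [s], [t] of the sides [c i], [c j]. *)
Definition CAT_m1 : Prop :=
  geodesic_space /\
  forall (v : 'I_3 -> X) (c : 'I_3 -> R -> X) (w : 'I_3 -> hplane R),
    (forall i, geodesic (v i) (v (ordS i)) (c i)) ->
    (forall i, hdist (w i) (w (ordS i)) = mdist (v i) (v (ordS i))) ->
  forall (i j : 'I_3) (s t : R) (a b : hplane R),
    s \in `[0, mdist (v i) (v (ordS i))] ->
    t \in `[0, mdist (v j) (v (ordS j))] ->
    hdist (w i) a = s -> hdist a (w (ordS i)) = mdist (v i) (v (ordS i)) - s ->
    hdist (w j) b = t -> hdist b (w (ordS j)) = mdist (v j) (v (ordS j)) - t ->
  mdist (c i s) (c j t) <= hdist a b.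

End cat.

Section boundary.
Context {R : realType} {X : metricType R} (o : X).

Definition gromov (x y : X) : R := (mdist x o + mdist y o - mdist x y) / 2.

Definition gromov_seq (u : nat -> X) : Prop :=
  gromov (u nm.1) (u nm.2) @[nm --> (\oo, \oo)] --> +oo.

Definition gromov_equiv (u v : nat -> X) : Prop :=
  gromov (u n) (v n) @[n --> \oo] --> +oo.

(* A point of the boundary is an equivalence class of sequences. *)
Record boundary := Boundary {
  bd_class :> set (nat -> X);
  bd_classP : exists2 u, gromov_seq u &
    bd_class = [set v | gromov_seq v /\ gromov_equiv u v] }.

(* The continuous extension of the Gromov product to the boundary; its value
   at [(xi, xi)] is [+oo]. *)
Definition gromov_bd (xi zeta : boundary) : \bar R :=
  get [set l : \bar R | forall u v : nat -> X, bd_class xi u -> bd_class zeta v ->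
    (gromov (u nm.1) (v nm.2))%:E @[nm --> (\oo, \oo)] --> l].

Definition visual_dist (xi zeta : boundary) : R :=
  fine (expeR (- gromov_bd xi zeta)%E).

(* The sequence [rho (g n) o] converges to [xi] when it belongs to [xi]. *)
Definition limit_set (r : nat) (rho : representation r X) : set boundary :=
  [set xi | exists g : nat -> free_group r, bd_class xi (fun n => rho (g n) o)].

Definition schottky (r : nat) (rho : representation r X) : Prop :=
  exists2 K : R, 1 <= K & forall g h : free_group r,
    let l := (word_length (g^-1 * h)%g)%:R in
    l / K - K <= mdist (rho g o) (rho h o) <= K * l + K.

End boundary.
Arguments visual_dist {R X} o xi zeta.
Arguments gromov_bd {R X} o xi zeta.
Arguments limit_set {R X} o {r} rho _.

Section hausdorff.
Context {R : realType} {T : Type} (d : T -> T -> R).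
Implicit Types A B U : set T.

Definition thickening (e : R) A : set T := [set x | exists2 y, A y & d x y < e].

(* Infinite between the empty set and a nonempty one. *)
Definition hausdorff_dist A B : \bar R :=
  ereal_inf [set e%:E | e in [set e : R |
    [/\ 0 < e, A `<=` thickening e B & B `<=` thickening e A]]].

Definition diam U : \bar R :=
  ereal_sup [set (d xy.1 xy.2)%:E | xy in U `*` U].

(* The empty set weighs 0 also when [s = 0]. *)
Definition diam_pow (s : R) U : \bar R :=
  if U == set0 then 0%E else (diam U `^ s)%E.

Definition hausdorff_content (s delta : R) A : \bar R :=
  ereal_inf [set (\sum_(0 <= i <oo) diam_pow s (U i))%E | U in
    [set U : nat -> set T |
      A `<=` \bigcup_i U i /\ forall i, (diam (U i) <= delta%:E)%E]].

Definition hausdorff_measure (s : R) A : \bar R :=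
  ereal_sup [set hausdorff_content s delta A | delta in [set delta | 0 < delta]].

Definition Hdim A : \bar R :=
  ereal_inf [set s%:E | s in [set s : R | 0 <= s /\ hausdorff_measure s A = 0%E]].

End hausdorff.

(* Main.v *)
Require Import Defs.
From mathcomp Require Import all_boot all_order all_algebra.
From mathcomp Require Import all_classical all_reals all_analysis.
From mathcomp Require Import ring lra zify.
Import numFieldNormedType.Exports.

Set Implicit Arguments.
Unset Strict Implicit.
Unset Printing Implicit Defensive.

Import Order.TTheory GRing.Theory Num.Theory.

Local Open Scope classical_set_scope.
Local Open Scope ring_scope.

(** Write D(x,y) = exp(- <x,y>_o). The proof rests on one inequality of the space
X and on one estimate for orbits.

The inequality is the triangle inequality for D between points of X
([CAT_visual_triangle]). It is a form of strong hyperbolicity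
([CAT_strongly_hyperbolic]): for a quadrilateral with diagonals [xy] and [zo],
exp((xy + zo)/2) <= exp((xz + yo)/2) + exp((yz + xo)/2). In the half plane this
is a comparison with ideal points ([quadrilateral]); it passes to X by placing
comparison triangles of x and of y on the two sides of a common copy of [zo].
It has two uses. Gromov products along sequences that converge to the boundary
converge, so that the visual distance is the limit of D along arbitrary
representatives ([visual_cvg]). And X satisfies Gromov's four-point condition
([CAT_four_point]), from which the estimate for orbits is derived.

The estimate: for each e > 0 and all large k, d(o, R_k(v) o) and
d(o, R_oo(v) o) differ by at most e d(o, R_oo(v) o) + 1, for every v in the free
group ([stability]). By the Morse lemma ([morse]) a reduced word of a Schottky
representation never turns back by more than a constant a at any letter. Cut a
reduced word into blocks of N letters. The turns between blocks and the lengths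
of the blocks involve finitely many group elements, hence are almost the same
for R_k and R_oo when k is large. A local-to-global argument then bounds all
turns of R_k ([global_turn]) and makes orbit lengths additive along the blocks,
with an error per block that does not grow with N, whereas the length of a block
grows linearly in N ([orbit_length_close]).

The Gromov product of two orbit points is, up to a constant, the orbit length of
the common prefix of the two words ([gromov_branch]), so Gromov products for R_k
and R_oo are related in the same way ([gromov_orbit_close]). Therefore
R_k(g_n) o converges to the boundary if and only if R_oo(g_n) o does, and the
resulting correspondence between limit sets is Hoelder in both directions, with
an exponent s that tends to 1. A Hoelder correspondence of exponent s multiplies
Hausdorff dimensions by at most 1/s ([Hdim_holder]), which gives the convergence
of dimensions. Two corresponding points are visually close, uniformly, because
R_k(g) o and R_oo(g) o stay close along the first letters of a long word g
([gromov_orbit_large]); this gives the Hausdorff convergence. *)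

(** * An inequality for quadrilaterals of the half plane *)
Section half_plane.
Context {R : realType}.
Implicit Types u v w h q t m H a b : R.

Lemma arcosh_half_sum t : 1 <= t -> arcosh ((t + t^-1) / 2) = ln t.
Proof.
move=> t1; have t0 : 0 < t by apply: lt_le_trans t1.
rewrite /arcosh; congr ln.
have -> : ((t + t^-1) / 2) ^+ 2 - 1 = ((t - t^-1) / 2) ^+ 2 by field; lra.
rewrite sqrtr_sqr ger0_norm; first by field; lra.
by rewrite divr_ge0// subr_ge0 (le_trans _ t1)// invf_le1.
Qed.

(** The exponential of the hyperbolic distance between (u, v) and (0, h).
Comparison triangles are placed with one side on the vertical axis. *)
Definition axis_exp u v h : R :=
  (u ^+ 2 + v ^+ 2 + h ^+ 2
    + Num.sqrt ((u ^+ 2 + v ^+ 2 - h ^+ 2) ^+ 2 + 4 * h ^+ 2 * u ^+ 2))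
  / (2 * v * h).

Lemma expR_hdist_axis (z w : hplane R) : hre z = 0 ->
  expR (hdist z w) = axis_exp (hre w) (him w) (him z).
Proof.
move=> z0; have h0 := him_gt0 z; have v0 := him_gt0 w; rewrite /hdist /axis_exp z0.
set u := hre w; set v := him w in v0 *; set h := him z in h0 *.
set t := 1 + _.
have -> : t = (u ^+ 2 + v ^+ 2 + h ^+ 2) / (2 * v * h).
  by rewrite /t; field; apply/andP; lra.
rewrite /arcosh.
set c := _ / _.
have -> : c ^+ 2 - 1 =
    ((u ^+ 2 + v ^+ 2 - h ^+ 2) ^+ 2 + 4 * h ^+ 2 * u ^+ 2) / (2 * v * h) ^+ 2.
  by rewrite /c; field; apply/andP; lra.
have vh : 0 < 2 * v * h by rewrite !mulr_gt0.
rewrite sqrtrM; last by rewrite addr_ge0 ?sqr_ge0// mulr_ge0 ?sqr_ge0// mulr_ge0 ?sqr_ge0.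
have n0 : 0 < u ^+ 2 + v ^+ 2 + h ^+ 2.
  by rewrite ltr_wpDl ?addr_ge0 ?sqr_ge0// exprn_gt0.
rewrite sqrtrV ?sqr_ge0// sqrtr_sqr ger0_norm ?(ltW vh)// lnK.
  by rewrite /c -mulrDl.
by rewrite posrE ltr_pwDl ?divr_gt0// divr_ge0 ?sqrtr_ge0 ?(ltW vh).
Qed.

Lemma axis_exp_gt0 u v h : 0 < v -> 0 < h -> 0 < axis_exp u v h.
Proof.
move=> v0 h0; rewrite /axis_exp divr_gt0// ?mulr_gt0//.
rewrite ltr_pwDl ?sqrtr_ge0//.
by rewrite ltr_wpDl ?addr_ge0 ?sqr_ge0// exprn_gt0.
Qed.

(** This and [axis_exp_ge_top] bound the distance below by the Busemann functions
of the two ends 0 and oo of the axis. *)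
Lemma axis_exp_ge_bottom u v h : 0 < v -> 0 < h ->
  (u ^+ 2 + v ^+ 2) / (v * h) <= axis_exp u v h.
Proof.
move=> v0 h0; rewrite /axis_exp.
set q := u ^+ 2 + v ^+ 2.
have : q - h ^+ 2 <= Num.sqrt ((q - h ^+ 2) ^+ 2 + 4 * h ^+ 2 * u ^+ 2).
  rewrite (le_trans (ler_norm _))// -sqrtr_sqr ler_wsqrtr// lerDl.
  by rewrite mulr_ge0 ?sqr_ge0// mulr_ge0 ?sqr_ge0.
set r := Num.sqrt _ => rq.
have -> : q / (v * h) = (2 * q) / (2 * v * h) by field; apply/andP; lra.
rewrite ler_pM2r; first by lra.
by rewrite invr_gt0 !mulr_gt0.
Qed.

Lemma axis_exp_ge_top u v h : 0 < v -> 0 < h -> h / v <= axis_exp u v h.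
Proof.
move=> v0 h0; rewrite /axis_exp.
set q := u ^+ 2 + v ^+ 2.
have : - (q - h ^+ 2) <= Num.sqrt ((q - h ^+ 2) ^+ 2 + 4 * h ^+ 2 * u ^+ 2).
  rewrite (le_trans (ler_norm _))// normrN -sqrtr_sqr ler_wsqrtr// lerDl.
  by rewrite mulr_ge0 ?sqr_ge0// mulr_ge0 ?sqr_ge0.
set r := Num.sqrt _ => rq.
have -> : h / v = (2 * h ^+ 2) / (2 * v * h) by field; apply/andP; lra.
rewrite ler_pM2r; first by lra.
by rewrite invr_gt0 !mulr_gt0.
Qed.

(** The geodesic from (- u1, v1) to (u2, v2) is an arc of a circle centred on the
real line, and it crosses the axis at the height h of the hypothesis. There the
two distances add up to the distance D of the two points, and the right-hand side
is 2 cosh D. When u1 = u2 = 0 both points are on the axis, the equation for h is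
void, and h is the height of the first one. *)
Lemma crossing_bound u1 v1 u2 v2 h : 0 <= u1 -> 0 <= u2 -> 0 < v1 -> 0 < v2 ->
  0 < h -> h ^+ 2 * (u1 + u2) = (u1 ^+ 2 + v1 ^+ 2) * u2 + (u2 ^+ 2 + v2 ^+ 2) * u1 ->
  (u1 + u2 = 0 -> h = v1) ->
  axis_exp u1 v1 h * axis_exp u2 v2 h <=
    (u1 ^+ 2 + v1 ^+ 2 + (u2 ^+ 2 + v2 ^+ 2) + 2 * (u1 * u2)) / (v1 * v2).
Proof.
move=> u10 u20 v10 v20 h0; rewrite /axis_exp.
set q1 := u1 ^+ 2 + v1 ^+ 2; set q2 := u2 ^+ 2 + v2 ^+ 2 => hE hv.
set r1 := Num.sqrt _; set r2 := Num.sqrt _.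
have -> : (q1 + h ^+ 2 + r1) / (2 * v1 * h) * ((q2 + h ^+ 2 + r2) / (2 * v2 * h))
  = ((q1 + h ^+ 2 + r1) * (q2 + h ^+ 2 + r2) / (4 * h ^+ 2)) / (v1 * v2).
  by field; rewrite !gt_eqF.
rewrite ler_pM2r ?invr_gt0 ?mulr_gt0//.
rewrite ler_pdivrMr ?mulr_gt0 ?exprn_gt0//.
have q10 : 0 <= q1 by rewrite addr_ge0 ?sqr_ge0.
have q20 : 0 <= q2 by rewrite addr_ge0 ?sqr_ge0.
have [s0|s0] := eqVneq (u1 + u2) 0.
  have u1E : u1 = 0 by lra.
  have u2E : u2 = 0 by lra.
  have q1E : q1 = h ^+ 2 by rewrite /q1 u1E expr0n add0r -hv.
  have -> : r1 = 0 by rewrite /r1 u1E q1E subrr expr0n /= mulr0 addr0 sqrtr0.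
  have -> : r2 = `|q2 - h ^+ 2| by rewrite /r2 u2E expr0n /= mulr0 addr0 sqrtr_sqr.
  rewrite u1E u2E q1E !mulr0 !addr0; rewrite q1E in q10.
  have h20 : 0 < h ^+ 2 by rewrite exprn_gt0.
  have Aq : 0 <= h ^+ 2 * q2 by rewrite mulr_ge0.
  have AA : 0 <= h ^+ 2 * h ^+ 2 by rewrite mulr_ge0.
  by case: (ger0P (q2 - h ^+ 2)) => _; move: Aq AA; move: (h ^+ 2) => A; nra.
have {}s0 : 0 < u1 + u2 by rewrite lt_neqAle eq_sym s0 addr_ge0.
(* [k / 2] and [t / 2] are the centre and the radius of the circle. *)
pose k := (q2 - q1) / (u1 + u2).
pose t := Num.sqrt (k ^+ 2 + 4 * h ^+ 2).
have t0 : 0 <= t by rewrite sqrtr_ge0.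
have kE : k * (u1 + u2) = q2 - q1 by rewrite divfK ?gt_eqF.
have q1E : q1 = h ^+ 2 - u1 * k.
  by apply: (mulIf (lt0r_neq0 s0)); rewrite mulrBl -[u1 * k * _]mulrA kE hE; ring.
have q2E : q2 = h ^+ 2 + u2 * k.
  by apply: (mulIf (lt0r_neq0 s0)); rewrite [RHS]mulrDl -[u2 * k * _]mulrA kE hE; ring.
have tE : t ^+ 2 = k ^+ 2 + 4 * h ^+ 2.
  by rewrite sqr_sqrtr// addr_ge0 ?sqr_ge0// mulr_ge0 ?sqr_ge0.
have -> : r1 = u1 * t.
  have -> : r1 = Num.sqrt ((u1 * t) ^+ 2).
    by rewrite /r1 exprMn tE q1E; congr Num.sqrt; ring.
  by rewrite sqrtr_sqr ger0_norm ?mulr_ge0.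
have -> : r2 = u2 * t.
  have -> : r2 = Num.sqrt ((u2 * t) ^+ 2).
    by rewrite /r2 exprMn tE q2E; congr Num.sqrt; ring.
  by rewrite sqrtr_sqr ger0_norm ?mulr_ge0.
have key : (u1 + u2) * t <= q1 + q2 + 2 * (u1 * u2).
  rewrite -(@ler_pXn2r _ 2)// ?nnegrE; last 2 first.
  - by rewrite mulr_ge0// ltW.
  - by apply: addr_ge0; [exact: addr_ge0|rewrite !mulr_ge0].
  rewrite exprMn tE -subr_ge0.
  have -> : (q1 + q2 + 2 * (u1 * u2)) ^+ 2 - (u1 + u2) ^+ 2 * (k ^+ 2 + 4 * h ^+ 2)
     = 4 * ((q1 - u1 ^+ 2) * (q2 - u2 ^+ 2)).
    rewrite mulrDr -exprMn [_ * k]mulrC kE.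
    have -> : (u1 + u2) ^+ 2 * (4 * h ^+ 2) = 4 * (u1 + u2) * (h ^+ 2 * (u1 + u2)) by ring.
    by rewrite hE; ring.
  rewrite mulr_ge0// mulr_ge0//.
    by rewrite /q1 addrC addrA addNr add0r sqr_ge0.
  by rewrite /q2 addrC addrA addNr add0r sqr_ge0.
have -> : (q1 + h ^+ 2 + u1 * t) * (q2 + h ^+ 2 + u2 * t)
   = (2 * h ^+ 2) * (q1 + q2 + (u1 + u2) * t + 2 * (u1 * u2)).
  have -> : (q1 + h ^+ 2 + u1 * t) * (q2 + h ^+ 2 + u2 * t) =
     (2 * h ^+ 2 + u1 * (t - k)) * (2 * h ^+ 2 + u2 * (t + k)) by rewrite q1E q2E; ring.
  transitivity (4 * h ^+ 2 * h ^+ 2 + 2 * h ^+ 2 * (u1 * (t - k) + u2 * (t + k))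
    + u1 * u2 * (t ^+ 2 - k ^+ 2)); first by ring.
  by rewrite tE q1E q2E; ring.
have : 0 < 2 * h ^+ 2 by rewrite mulr_gt0 ?exprn_gt0.
nra.
Qed.

(** Used when the geodesic misses the vertical side, that is when the
quadrilateral is not convex at an end of this side. Halve the two factors into
m1 and m2, so that m_i (m_i - t_i) = w_i^2. Then
(t1 w2 + t2 w1) m1 m2 = (m1 m2 - w1 w2) (w1 m2 + w2 m1), hence m1 m2 <= w1 w2;
and w_i^2 <= 1 + t_i gives w_i^2 <= m_i. Together (m1 m2)^2 <= m1 m2. *)
Lemma half_root_prod t1 w1 t2 w2 : 0 <= w1 -> 0 <= w2 ->
  w1 ^+ 2 <= 1 + t1 -> w2 ^+ 2 <= 1 + t2 -> t1 * w2 + t2 * w1 <= 0 -> 0 < w1 + w2 ->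
  (t1 + Num.sqrt (t1 ^+ 2 + 4 * w1 ^+ 2)) * (t2 + Num.sqrt (t2 ^+ 2 + 4 * w2 ^+ 2)) <= 4.
Proof.
move=> w10 w20 wt1 wt2 tw w0.
suff main m1 m2 : 0 <= m1 -> 0 <= m2 ->
    m1 * (m1 - t1) = w1 ^+ 2 -> m2 * (m2 - t2) = w2 ^+ 2 -> m1 * m2 <= 1.
  have P t w : 0 <= (t + Num.sqrt (t ^+ 2 + 4 * w ^+ 2)) / 2 /\
      (t + Num.sqrt (t ^+ 2 + 4 * w ^+ 2)) / 2 *
      ((t + Num.sqrt (t ^+ 2 + 4 * w ^+ 2)) / 2 - t) = w ^+ 2.
    have sE : Num.sqrt (t ^+ 2 + 4 * w ^+ 2) ^+ 2 = t ^+ 2 + 4 * w ^+ 2.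
      by rewrite sqr_sqrtr// addr_ge0 ?sqr_ge0// mulr_ge0 ?sqr_ge0.
    split.
      suff : - t <= Num.sqrt (t ^+ 2 + 4 * w ^+ 2) by lra.
      rewrite (le_trans (ler_norm _))// normrN -sqrtr_sqr ler_wsqrtr// lerDl.
      by rewrite mulr_ge0 ?sqr_ge0.
    move: sE; set s := Num.sqrt _ => sE.
    have -> : (t + s) / 2 * ((t + s) / 2 - t) = (s ^+ 2 - t ^+ 2) / 4 by field.
    by rewrite sE; field.
  have [p1 e1] := P t1 w1; have [p2 e2] := P t2 w2.
  by have := main _ _ p1 p2 e1 e2; lra.
move=> m10 m20 e1 e2.
have [->|m1n] := eqVneq m1 0; first by rewrite mul0r.
have [->|m2n] := eqVneq m2 0; first by rewrite mulr0.
have m1p : 0 < m1 by rewrite lt_neqAle eq_sym m1n.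
have m2p : 0 < m2 by rewrite lt_neqAle eq_sym m2n.
have prod_le : m1 * m2 <= w1 * w2.
  rewrite -subr_le0.
  suff : (m1 * m2 - w1 * w2) * (w1 * m2 + w2 * m1) <= 0.
    move=> H; rewrite leNgt; apply/negP => H0.
    suff : 0 < w1 * m2 + w2 * m1 by nra.
    by move: w10; rewrite le_eqVlt => /orP[/eqP w1E|w1p]; nra.
  have -> : (m1 * m2 - w1 * w2) * (w1 * m2 + w2 * m1) = (t1 * w2 + t2 * w1) * (m1 * m2).
    have -> : t1 * w2 + t2 * w1 =
        w2 * m1 + w1 * m2 - w2 * (m1 - t1) - w1 * (m2 - t2) by ring.
    transitivity ((w2 * m1 + w1 * m2) * (m1 * m2)
      - w2 * m2 * w1 ^+ 2 - w1 * m1 * w2 ^+ 2); first by ring.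
    by rewrite -e1 -e2; ring.
  by rewrite mulr_le0_ge0// mulr_ge0.
have wm w m t : 0 <= m -> m * (m - t) = w ^+ 2 -> w ^+ 2 <= 1 + t -> w ^+ 2 <= m.
  move=> m0 e wt; nra.
have a1 := wm _ _ _ m10 e1 wt1; have a2 := wm _ _ _ m20 e2 wt2.
have : (w1 * w2) ^+ 2 <= m1 * m2 by rewrite exprMn ler_pM ?sqr_ge0.
have : 0 < m1 * m2 by rewrite mulr_gt0.
nra.
Qed.

(** The squared right-hand side of strong hyperbolicity, since the square root of
[expR t] is [expR (t / 2)]. *)
Definition sq_sum a b : R := (Num.sqrt a + Num.sqrt b) ^+ 2.

Lemma le_sq_sum a b : 0 <= a -> 0 <= b -> a + b <= sq_sum a b.
Proof.
move=> a0 b0; rewrite /sq_sum sqrrD !sqr_sqrtr//.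
have : 0 <= Num.sqrt a * Num.sqrt b by rewrite mulr_ge0 ?sqrtr_ge0.
by set c := _ * _; rewrite mulr2n => ?; lra.
Qed.

(** The convex case. Moving the ends of the vertical side to 0 and oo turns the
claim into q1 + q2 + 2 u1 u2 <= (sqrt q1 + sqrt q2)^2, where q_i = u_i^2 + v_i^2. *)
Lemma crossing_inside u1 v1 u2 v2 h H : 0 <= u1 -> 0 <= u2 -> 0 < v1 -> 0 < v2 ->
  0 < h -> 0 < H ->
  h ^+ 2 * (u1 + u2) = (u1 ^+ 2 + v1 ^+ 2) * u2 + (u2 ^+ 2 + v2 ^+ 2) * u1 ->
  (u1 + u2 = 0 -> h = v1) ->
  axis_exp u1 v1 h * axis_exp u2 v2 h * H <=
    sq_sum (axis_exp u1 v1 1 * axis_exp u2 v2 H) (axis_exp u2 v2 1 * axis_exp u1 v1 H).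
Proof.
move=> u10 u20 v10 v20 h0 H0 hE hv.
have := crossing_bound u10 u20 v10 v20 h0 hE hv.
rewrite -(ler_pM2r H0) => /le_trans; apply.
have a1 := axis_exp_ge_bottom u1 v10 (@ltr01 R).
have a2 := axis_exp_ge_bottom u2 v20 (@ltr01 R).
have b1 := axis_exp_ge_top u1 v10 H0; have b2 := axis_exp_ge_top u2 v20 H0.
rewrite !mulr1 in a1 a2.
set q1 := u1 ^+ 2 + v1 ^+ 2 in a1 *; set q2 := u2 ^+ 2 + v2 ^+ 2 in a2 *.
have q10 : 0 <= q1 by rewrite addr_ge0 ?sqr_ge0.
have q20 : 0 <= q2 by rewrite addr_ge0 ?sqr_ge0.
have c1 : q1 / v1 * (H / v2) <= axis_exp u1 v1 1 * axis_exp u2 v2 H.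
  by rewrite ler_pM// divr_ge0 ?(ltW H0) ?(ltW v10) ?(ltW v20).
have c2 : q2 / v2 * (H / v1) <= axis_exp u2 v2 1 * axis_exp u1 v1 H.
  by rewrite ler_pM// divr_ge0 ?(ltW H0) ?(ltW v10) ?(ltW v20).
have k0 : 0 <= H / (v1 * v2) by rewrite divr_ge0 ?mulr_ge0 ?ltW.
have u1q : u1 <= Num.sqrt q1.
  by rewrite -(ger0_norm u10) -sqrtr_sqr ler_wsqrtr// lerDl sqr_ge0.
have u2q : u2 <= Num.sqrt q2.
  by rewrite -(ger0_norm u20) -sqrtr_sqr ler_wsqrtr// lerDl sqr_ge0.
apply: (@le_trans _ _ (sq_sum (q1 / v1 * (H / v2)) (q2 / v2 * (H / v1)))); last first.
  by rewrite /sq_sum ler_sqr ?nnegrE ?addr_ge0 ?sqrtr_ge0// lerD// ler_wsqrtr.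
have -> : q1 / v1 * (H / v2) = q1 * (H / (v1 * v2)) by field; apply/andP; lra.
have -> : q2 / v2 * (H / v1) = q2 * (H / (v1 * v2)) by field; apply/andP; lra.
rewrite mulrAC -[leLHS]mulrA.
move: k0; set k := H / (v1 * v2) => k0.
rewrite /sq_sum (sqrtrM k)// (sqrtrM k)// -mulrDl exprMn sqr_sqrtr//.
rewrite ler_wpM2r//.
rewrite sqrrD !sqr_sqrtr// mulr2n.
have : u1 * u2 <= Num.sqrt q1 * Num.sqrt q2 by rewrite ler_pM.
lra.
Qed.

(** Here the path from one point to the other is taken through (0, 1). With
A_i = 2 + t_i + sqrt (t_i^2 + 4 u_i^2), so that [axis_exp u_i v_i 1] is
A_i / (2 v_i), the hypothesis reads A1 A2 <= 2 (A1 + A2), and this is the claim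
once (0, H) is moved to the ideal point oo. *)
Lemma crossing_below u1 v1 u2 v2 H : 0 < v1 -> 0 < v2 -> 0 < H ->
  let t1 := u1 ^+ 2 + v1 ^+ 2 - 1 in let t2 := u2 ^+ 2 + v2 ^+ 2 - 1 in
  (t1 + Num.sqrt (t1 ^+ 2 + 4 * u1 ^+ 2)) * (t2 + Num.sqrt (t2 ^+ 2 + 4 * u2 ^+ 2)) <= 4 ->
  axis_exp u1 v1 1 * axis_exp u2 v2 1 * H <=
    sq_sum (axis_exp u1 v1 1 * axis_exp u2 v2 H) (axis_exp u2 v2 1 * axis_exp u1 v1 H).
Proof.
move=> v10 v20 H0 t1 t2 t12.
have e1 := axis_exp_gt0 u1 v10 (@ltr01 R); have e2 := axis_exp_gt0 u2 v20 (@ltr01 R).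
have f1 := axis_exp_gt0 u1 v10 H0; have f2 := axis_exp_gt0 u2 v20 H0.
have b1 := axis_exp_ge_top u1 v10 H0; have b2 := axis_exp_ge_top u2 v20 H0.
apply: le_trans (le_sq_sum _ _); [|by rewrite mulr_ge0 ?ltW..].
apply: (@le_trans _ _ (axis_exp u1 v1 1 * (H / v2) + axis_exp u2 v2 1 * (H / v1))); last first.
  by apply: lerD; rewrite ler_wpM2l ?(ltW e1) ?(ltW e2).
rewrite /axis_exp !expr1n !mulr1 -/t1 -/t2.
have -> : u1 ^+ 2 + v1 ^+ 2 + 1 = 2 + t1 by rewrite /t1; ring.
have -> : u2 ^+ 2 + v2 ^+ 2 + 1 = 2 + t2 by rewrite /t2; ring.
move: t12; set r1 := Num.sqrt _; set r2 := Num.sqrt _ => t12.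
have -> : (2 + t1 + r1) / (2 * v1) * ((2 + t2 + r2) / (2 * v2)) * H =
   (2 + t1 + r1) * (2 + t2 + r2) * (H / (4 * v1 * v2)) by field; apply/andP; lra.
have -> : (2 + t1 + r1) / (2 * v1) * (H / v2) + (2 + t2 + r2) / (2 * v2) * (H / v1) =
   2 * ((2 + t1 + r1) + (2 + t2 + r2)) * (H / (4 * v1 * v2)) by field; apply/andP; lra.
rewrite ler_pM2r; first by move: t12; clear; move: (t1) (t2) => ? ?; nra.
by rewrite divr_gt0// !mulr_gt0.
Qed.

(** The image of [crossing_below] under the inversion that exchanges (0, 1) and
(0, H). *)
Lemma crossing_above u1 v1 u2 v2 H : 0 < v1 -> 0 < v2 -> 0 < H ->
  let q1 := u1 ^+ 2 + v1 ^+ 2 in let q2 := u2 ^+ 2 + v2 ^+ 2 in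
  (H ^+ 2 - q1 + Num.sqrt ((q1 - H ^+ 2) ^+ 2 + 4 * H ^+ 2 * u1 ^+ 2)) *
  (H ^+ 2 - q2 + Num.sqrt ((q2 - H ^+ 2) ^+ 2 + 4 * H ^+ 2 * u2 ^+ 2)) <= 4 * (q1 * q2) ->
  axis_exp u1 v1 H * axis_exp u2 v2 H * H <=
    sq_sum (axis_exp u1 v1 1 * axis_exp u2 v2 H) (axis_exp u2 v2 1 * axis_exp u1 v1 H).
Proof.
move=> v10 v20 H0 q1 q2 t12.
have e1 := axis_exp_gt0 u1 v10 (@ltr01 R); have e2 := axis_exp_gt0 u2 v20 (@ltr01 R).
have f1 := axis_exp_gt0 u1 v10 H0; have f2 := axis_exp_gt0 u2 v20 H0.
have a1 := axis_exp_ge_bottom u1 v10 (@ltr01 R).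
have a2 := axis_exp_ge_bottom u2 v20 (@ltr01 R).
rewrite !mulr1 in a1 a2.
apply: le_trans (le_sq_sum _ _); [|by rewrite mulr_ge0 ?ltW..].
apply: (@le_trans _ _ (q1 / v1 * axis_exp u2 v2 H + q2 / v2 * axis_exp u1 v1 H)); last first.
  by apply: lerD; rewrite ler_wpM2r ?(ltW f1) ?(ltW f2).
rewrite /axis_exp -/q1 -/q2.
move: t12; set r1 := Num.sqrt _; set r2 := Num.sqrt _ => t12.
have -> : (q1 + H ^+ 2 + r1) / (2 * v1 * H) * ((q2 + H ^+ 2 + r2) / (2 * v2 * H)) * H =
   (q1 + H ^+ 2 + r1) * (q2 + H ^+ 2 + r2) * (4 * v1 * v2 * H)^-1.
  by field; rewrite !gt_eqF.
have -> : q1 / v1 * ((q2 + H ^+ 2 + r2) / (2 * v2 * H)) +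
    q2 / v2 * ((q1 + H ^+ 2 + r1) / (2 * v1 * H)) =
   2 * (q1 * (q2 + H ^+ 2 + r2) + q2 * (q1 + H ^+ 2 + r1)) * (4 * v1 * v2 * H)^-1.
  by field; rewrite !gt_eqF.
rewrite ler_pM2r; first by move: t12; clear; move: (q1) (q2) => ? ?; move: (H ^+ 2) => ?; nra.
by rewrite invr_gt0 !mulr_gt0.
Qed.

(** The quadrilateral has a diagonal on the axis, from z = (0, 1) to o = (0, H),
and its other vertices x, y are at (- u1, v1) and (u2, v2). The height h is that
of the point where the geodesic from x to y crosses the axis, or of the nearest
end of the diagonal if this point is not on the diagonal. *)
Lemma quadrilateral u1 v1 u2 v2 H : 0 <= u1 -> 0 <= u2 -> 0 < v1 -> 0 < v2 -> 1 <= H ->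
  exists h, [/\ 1 <= h, h <= H & axis_exp u1 v1 h * axis_exp u2 v2 h * H <=
    sq_sum (axis_exp u1 v1 1 * axis_exp u2 v2 H) (axis_exp u2 v2 1 * axis_exp u1 v1 H)].
Proof.
move=> u10 u20 v10 v20 H1; have H0 : 0 < H by apply: lt_le_trans H1.
set q1 := u1 ^+ 2 + v1 ^+ 2; set q2 := u2 ^+ 2 + v2 ^+ 2.
have q10 : 0 < q1 by rewrite ltr_wpDl ?sqr_ge0 ?exprn_gt0.
have q20 : 0 < q2 by rewrite ltr_wpDl ?sqr_ge0 ?exprn_gt0.
pose h := if u1 + u2 == 0 then v1 else Num.sqrt ((q1 * u2 + q2 * u1) / (u1 + u2)).
have s0 : u1 + u2 != 0 -> 0 < u1 + u2.
  by move=> e; rewrite lt_neqAle eq_sym e addr_ge0.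
have hE : h ^+ 2 * (u1 + u2) = q1 * u2 + q2 * u1.
  rewrite /h; case: (eqVneq (u1 + u2) 0) => [e|/s0 e].
    have -> : u1 = 0 by lra.
    have -> : u2 = 0 by lra.
    ring.
  by rewrite sqr_sqrtr ?divfK ?gt_eqF// divr_ge0 ?(ltW e)// addr_ge0// mulr_ge0// ltW.
have hv : u1 + u2 = 0 -> h = v1 by move=> e; rewrite /h e eqxx.
have h0 : 0 < h.
  rewrite /h; case: (eqVneq (u1 + u2) 0) => [//|/s0 e].
  rewrite sqrtr_gt0 divr_gt0//.
  have [u1n|u1p] := eqVneq u1 0.
    by rewrite u1n mulr0 addr0 mulr_gt0//; lra.
  by rewrite ltr_wpDl ?mulr_ge0 ?mulr_gt0 ?(ltW q10)// lt_neqAle eq_sym u1p.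
have [h1|h1] := leP 1 h; last first.
  exists 1; split => //; apply: crossing_below => //.
  have [e|/s0 e] := eqVneq (u1 + u2) 0.
    have u1E : u1 = 0 by lra.
    have -> : u1 ^+ 2 + v1 ^+ 2 - 1 = v1 ^+ 2 - 1 by rewrite u1E; ring.
    rewrite u1E expr0n mulr0 addr0 sqrtr_sqr ltr0_norm ?subrr ?mul0r// subr_lt0.
    by rewrite -(hv e) exprn_ilt1 ?ltW.
  apply: half_root_prod => //; rewrite ?(addrC 1) ?subrK ?lerDl ?sqr_ge0//.
  have -> : (u1 ^+ 2 + v1 ^+ 2 - 1) * u2 + (u2 ^+ 2 + v2 ^+ 2 - 1) * u1 =
     (h ^+ 2 - 1) * (u1 + u2) by rewrite [RHS]mulrBl hE /q1 /q2; ring.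
  by rewrite mulr_le0_ge0 ?(ltW e)// subr_le0 exprn_ile1 ?ltW.
have [hH|hH] := leP h H; first by exists h; split => //; exact: crossing_inside.
exists H; split => //; apply: crossing_above => //; rewrite -/q1 -/q2.
(* The inversion maps [u] to [H * u / q] and [q] to [H ^+ 2 / q]. *)
have HE u q : 0 < q -> H ^+ 2 - q + Num.sqrt ((q - H ^+ 2) ^+ 2 + 4 * H ^+ 2 * u ^+ 2) =
    q * ((H ^+ 2 / q - 1) + Num.sqrt ((H ^+ 2 / q - 1) ^+ 2 + 4 * (H * u / q) ^+ 2)).
  move=> q0; rewrite mulrDr; congr (_ + _); first by field; lra.
  have -> : (q - H ^+ 2) ^+ 2 + 4 * H ^+ 2 * u ^+ 2 =
     q ^+ 2 * ((H ^+ 2 / q - 1) ^+ 2 + 4 * (H * u / q) ^+ 2) by field; lra.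
  by rewrite sqrtrM ?sqr_ge0// sqrtr_sqr gtr0_norm.
rewrite !HE// mulrACA [leRHS]mulrC ler_wpM2l ?mulr_ge0 ?(ltW q10) ?(ltW q20)//.
have [e|/s0 e] := eqVneq (u1 + u2) 0.
  have u1E : u1 = 0 by lra.
  have q1E : q1 = v1 ^+ 2 by rewrite /q1 u1E; ring.
  rewrite u1E mulr0 mul0r expr0n mulr0 addr0 sqrtr_sqr ltr0_norm ?subrr ?mul0r// subr_lt0.
  by rewrite ltr_pdivrMr// mul1r q1E -(hv e) ltrXn2r ?ltW.
have W u v : 0 < u ^+ 2 + v ^+ 2 ->
   (H * u / (u ^+ 2 + v ^+ 2)) ^+ 2 <= 1 + (H ^+ 2 / (u ^+ 2 + v ^+ 2) - 1).
  move=> q0; rewrite [leRHS]addrC subrK !exprMn -mulrA ler_wpM2l ?sqr_ge0//.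
  set q := _ + _ in q0 *.
  rewrite expr2 mulrA ler_piMl ?invr_ge0 ?(ltW q0)// ler_pdivrMr// mul1r.
  by rewrite lerDl sqr_ge0.
apply: half_root_prod; rewrite ?divr_ge0 ?mulr_ge0 ?(ltW H0) ?(ltW q10) ?(ltW q20)//; try exact: W.
  have -> : (H ^+ 2 / q1 - 1) * (H * u2 / q2) + (H ^+ 2 / q2 - 1) * (H * u1 / q1) =
    H / (q1 * q2) * (H ^+ 2 * (u1 + u2) - (q1 * u2 + q2 * u1)) by field; rewrite !gt_eqF.
  rewrite -hE -mulrBl mulr_ge0_le0 ?divr_ge0 ?mulr_ge0 ?(ltW H0) ?(ltW q10) ?(ltW q20)//.
  by rewrite mulr_le0_ge0 ?(ltW e)// subr_le0 lerXn2r ?nnegrE ?ltW.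
have p1 : 0 < H / q1 by rewrite divr_gt0.
have p2 : 0 < H / q2 by rewrite divr_gt0.
rewrite !(mulrC H) -!mulrA.
move: u10; rewrite le_eqVlt => /orP[/eqP u1E|u1p].
  by rewrite -u1E mul0r add0r mulr_gt0//; lra.
by apply: ltr_pwDl; [exact: mulr_gt0|apply: mulr_ge0 => //; exact: ltW].
Qed.

End half_plane.

(** * Strong hyperbolicity of CAT(-1) spaces *)
Section comparison.
Context {R : realType}.
Implicit Types u v w h q t m H a b : R.

Lemma axis_exp_eq u v h a : 0 < v -> 0 < h -> 1 <= a ->
  u ^+ 2 + v ^+ 2 + h ^+ 2 = v * h * (a + a^-1) -> axis_exp u v h = a.
Proof.
move=> v0 h0 a1 E; have a0 : 0 < a by apply: lt_le_trans a1.
have aV : a^-1 <= a by rewrite (le_trans _ a1)// invf_le1.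
rewrite /axis_exp.
have -> : (u ^+ 2 + v ^+ 2 - h ^+ 2) ^+ 2 + 4 * h ^+ 2 * u ^+ 2 = (v * h * (a - a^-1)) ^+ 2.
  transitivity ((u ^+ 2 + v ^+ 2 + h ^+ 2) ^+ 2 - 4 * h ^+ 2 * v ^+ 2); first by ring.
  by rewrite E; field; lra.
rewrite sqrtr_sqr ger0_norm ?E; last first.
  by rewrite mulr_ge0 ?subr_ge0 ?mulr_ge0 ?(ltW v0) ?(ltW h0).
by field; rewrite !gt_eqF.
Qed.

(** A triangle with two vertices (0, 1), (0, H) and exponential side lengths a, b
at the third vertex. The equations u^2 + v^2 + 1 = v (a + 1/a) and
u^2 + v^2 + H^2 = v H (b + 1/b) determine v; then u^2 = (a - v) (v - 1/a), and the
triangle inequalities say that v lies between 1/a and a. *)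
Lemma comparison_point a b H : 1 <= a -> 1 <= b -> 1 < H ->
  b <= a * H -> a <= b * H -> H <= a * b ->
  exists u v, [/\ 0 <= u, 0 < v, axis_exp u v 1 = a & axis_exp u v H = b].
Proof.
move=> a1 b1 H1 baH abH Hab.
have a0 : 0 < a by apply: lt_le_trans a1.
have b0 : 0 < b by apply: lt_le_trans b1.
have H0 : 0 < H by apply: lt_trans H1.
pose ca := a + a^-1; pose cb := b + b^-1.
have aV : a * a^-1 = 1 by rewrite divff ?gt_eqF.
have aV0 : 0 < a^-1 by rewrite invr_gt0.
have bV0 : 0 < b^-1 by rewrite invr_gt0.
have aV1 : a^-1 <= 1 by rewrite invf_le1.
have bV1 : b^-1 <= 1 by rewrite invf_le1.
(* [k1] gives v <= a and [k2] gives 1/a <= v. *)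
have k1 : H ^+ 2 - H * a * cb + a ^+ 2 <= 0.
  have -> : H ^+ 2 - H * a * cb + a ^+ 2 = (a - H * b) * (a - H * b^-1).
    by rewrite /cb; field; lra.
  rewrite mulr_le0_ge0// ?subr_le0 ?subr_ge0; first by rewrite mulrC.
  by rewrite ler_pdivrMr.
have k2 : 0 <= H ^+ 2 - H * a^-1 * cb + a^-1 ^+ 2.
  have -> : H ^+ 2 - H * a^-1 * cb + a^-1 ^+ 2 = (H - b * a^-1) * (H - a^-1 * b^-1).
    by rewrite /cb; field; apply/andP; lra.
  rewrite mulr_ge0// subr_ge0; first by rewrite ler_pdivrMr// mulrC.
  by rewrite (le_trans _ (ltW H1))// mulr_ile1// ltW.
have d0 : 0 < H * cb - ca.
  suff : 0 < a * (H * cb - ca) by rewrite pmulr_rgt0.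
  rewrite mulrBr /ca [a * (a + _)]mulrDr aV.
  have -> : a * (H * cb) = H * a * cb by ring.
  have : 1 < H ^+ 2 by rewrite exprn_egt1.
  by move: k1; rewrite expr2; move: (H * a * cb) => ?; lra.
pose v := (H ^+ 2 - 1) / (H * cb - ca).
have H2 : 1 < H ^+ 2 by rewrite exprn_egt1.
have v0 : 0 < v by rewrite divr_gt0// subr_gt0.
have vE : v * (H * cb - ca) = H ^+ 2 - 1 by rewrite divfK ?gt_eqF.
have va : v <= a.
  rewrite -(ler_pM2r d0) vE mulrBr /ca [a * (a + _)]mulrDr aV.
  have -> : a * (H * cb) = H * a * cb by ring.
  by move: k1; rewrite [a ^+ 2]expr2; move: (H * a * cb) => ?; lra.
have av : a^-1 <= v.
  rewrite -(ler_pM2r d0) vE mulrBr /ca [a^-1 * (a + _)]mulrDr [a^-1 * a]mulrC aV.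
  have -> : a^-1 * (H * cb) = H * a^-1 * cb by ring.
  by move: k2; rewrite [a^-1 ^+ 2]expr2; move: (H * a^-1 * cb) => ?; lra.
have q0 : 0 <= v * ca - 1 - v ^+ 2.
  have -> : v * ca - 1 - v ^+ 2 = (a - v) * (v - a^-1).
    by rewrite /ca; field; lra.
  by rewrite mulr_ge0 ?subr_ge0.
exists (Num.sqrt (v * ca - 1 - v ^+ 2)), v; split=> //.
- by apply: axis_exp_eq => //; rewrite sqr_sqrtr// -/ca; ring.
- apply: axis_exp_eq => //; rewrite sqr_sqrtr// -/cb.
  have -> : v * ca - 1 - v ^+ 2 + v ^+ 2 + H ^+ 2 = v * ca + (H ^+ 2 - 1) by ring.
  by rewrite -vE; ring.
Qed.

Lemma hdist_sym (z w : hplane R) : hdist z w = hdist w z.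
Proof.
rewrite /hdist -[hre w - hre z]opprB sqrrN -[him w - him z]opprB sqrrN.
by rewrite mulrAC.
Qed.

Lemma hdist_vertical (z w : hplane R) : hre z = 0 -> hre w = 0 ->
  him z <= him w -> hdist z w = ln (him w / him z).
Proof.
move=> z0 w0 zw; have := him_gt0 z; have := him_gt0 w => w1 z1.
rewrite /hdist z0 w0 subrr expr0n add0r -arcosh_half_sum.
  by congr arcosh; field; rewrite !gt_eqF.
by rewrite ler_pdivlMr// mul1r.
Qed.

(** The point [c (ln h)] of the side from z to o corresponds to (0, h). The pair
(u, v) depends on x but the side does not, so that this can be used for two
points x at once. *)
Lemma CAT_axis (X : metricType R) (z o x : X) (c : R -> X) : CAT_m1 X ->
  geodesic z o c -> 0 < mdist z o ->
  exists u v, [/\ 0 <= u, 0 < v, axis_exp u v 1 = expR (mdist z x),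
    axis_exp u v (expR (mdist z o)) = expR (mdist o x) &
    forall h, 1 <= h -> h <= expR (mdist z o) ->
      expR (mdist (c (ln h)) x) <= axis_exp u v h].
Proof.
move=> [Xgeo Xcat] cg L0; set L := mdist z o in L0 *; set H := expR L.
have H1 : 1 < H by rewrite expR_gt1.
have H0 : 0 < H by rewrite expR_gt0.
have [] := @comparison_point (expR (mdist z x)) (expR (mdist o x)) H.
- by rewrite -expR0 ler_expR mdist_ge0.
- by rewrite -expR0 ler_expR mdist_ge0.
- by [].
- by rewrite -expRD ler_expR addrC /L (metric_sym z) metric_triangle.
- by rewrite -expRD ler_expR addrC metric_triangle.
- by rewrite -expRD ler_expR (metric_sym o) metric_triangle.
move=> u [v [u0 v0 e1 eH]]; exists u, v; split => // h h1 hH.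
have h0 : 0 < h by apply: lt_le_trans h1.
have [c1 c1g] := Xgeo o x; have [c2 c2g] := Xgeo x z.
pose V (i : 'I_3) : X := nth z [:: z; o; x] i.
pose C (i : 'I_3) : R -> X := nth c [:: c; c1; c2] i.
pose W0 : hplane R := HPlane 0 ltr01.
pose W1 : hplane R := HPlane 0 H0.
pose W2 : hplane R := HPlane u v0.
pose W (i : 'I_3) := nth W0 [:: W0; W1; W2] i.
pose P : hplane R := HPlane 0 h0.
have d01 : hdist W0 W1 = L by rewrite hdist_vertical//= ?divr1 ?expRK// ltW.
have d02 : hdist W0 W2 = mdist z x.
  by apply: expR_inj; rewrite expR_hdist_axis.
have d12 : hdist W1 W2 = mdist o x.
  by apply: expR_inj; rewrite expR_hdist_axis.
have d0P : hdist W0 P = ln h by rewrite hdist_vertical//= divr1.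
have dP1 : hdist P W1 = L - ln h.
  by rewrite hdist_vertical//= ln_div ?posrE// expRK.
have d22 : hdist W2 W2 = 0.
  by rewrite /hdist !subrr expr0n addr0 mul0r addr0 /arcosh expr1n subrr sqrtr0 addr0 ln1.
have lnh0 : 0 <= ln h by rewrite ln_ge0.
have lnhL : ln h <= L by rewrite -[L]expRK ler_ln ?posrE.
have Cg i : geodesic (V i) (V (ordS i)) (C i) by case: i => [[|[|[|]]]].
have Wd i : hdist (W i) (W (ordS i)) = mdist (V i) (V (ordS i)).
  by case: i => [[|[|[|]]]] //= ?; rewrite /W/V//= hdist_sym metric_sym.
have := Xcat V C W Cg Wd (@Ordinal 3 0 isT) (@Ordinal 3 2 isT) (ln h) 0 P W2.
rewrite {1 2 3 4}/V {1 2 3 4}/W /C /= !subr0.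
have [c20 _ _] := c2g.
rewrite c20 => Hc; rewrite -(@expR_hdist_axis _ P W2)// ler_expR.
apply: Hc => //.
- by rewrite in_itv /= lnh0.
- by rewrite in_itv /= lexx mdist_ge0.
- by rewrite hdist_sym d02 metric_sym.
Qed.

(** If p is a point of the geodesic from z to o, then xy <= xp + py, and both
terms are bounded in the half plane; [quadrilateral] chooses p. *)
Lemma CAT_strongly_hyperbolic (X : metricType R) (x y z o : X) : CAT_m1 X ->
  expR ((mdist x y + mdist z o) / 2) <=
  expR ((mdist x z + mdist y o) / 2) + expR ((mdist y z + mdist x o) / 2).
Proof.
move=> Xcat; have [c cg] := Xcat.1 z o.
have [L0|] := eqVneq (mdist z o) 0.
  rewrite L0 addr0 -(mdist_positivity _ _ L0) ler_wpDr ?expR_ge0// ler_expR ler_pM2r//.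
  by rewrite (metric_sym y) metric_triangle.
rewrite neq_lt ltNge mdist_ge0 /= => L0.
have [u1 [v1 [u10 v10 e1 f1 p1]]] := CAT_axis x Xcat cg L0.
have [u2 [v2 [u20 v20 e2 f2 p2]]] := CAT_axis y Xcat cg L0.
have H1 : 1 <= expR (mdist z o) by rewrite -expR0 ler_expR ltW.
have [h [h1 hH]] := quadrilateral u10 u20 v10 v20 H1.
rewrite e1 e2 f1 f2 /sq_sum -!expRD => main.
have sqE t : Num.sqrt (expR t) = expR (t / 2).
  by rewrite {1}(splitr t) expRD -expr2 sqrtr_sqr ger0_norm ?expR_ge0.
rewrite -ler_sqr ?nnegrE ?addr_ge0 ?expR_ge0//.
rewrite !sqE in main; rewrite -expRM_natl mulrC divfK//.
rewrite (metric_sym y o) (metric_sym y z) (metric_sym x o) (metric_sym x z) in main *.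
rewrite [X in _ + expR (X / 2)]addrC in main *.
apply: le_trans main; rewrite expRD ler_wpM2r ?expR_ge0//.
apply: (@le_trans _ _ (expR (mdist (c (ln h)) x) * expR (mdist (c (ln h)) y))).
  by rewrite -expRD ler_expR (metric_sym _ x) metric_triangle.
by apply: ler_pM; rewrite ?expR_ge0// ?p1// p2.
Qed.

End comparison.

(** * Gromov products and the Morse lemma *)
Section gromov_product.
Context {R : realType} {X : metricType R}.
Implicit Types x y z o : X.

Lemma gromov_sym o x y : gromov o x y = gromov o y x.
Proof. by rewrite /gromov (addrC (mdist x o)) (metric_sym x y). Qed.

Lemma gromov_ge0 o x y : 0 <= gromov o x y.
Proof.
by rewrite divr_ge0// subr_ge0 (metric_sym y) metric_triangle.
Qed.

Lemma gromov_lel o x y : gromov o x y <= mdist o x.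
Proof.
have := metric_triangle o x y; rewrite /gromov (metric_sym y) (metric_sym x o).
lra.
Qed.

Lemma gromov_ler o x y : gromov o x y <= mdist o y.
Proof. by rewrite gromov_sym gromov_lel. Qed.

Lemma gromov_lipl o x x' y : gromov o x y <= gromov o x' y + mdist x x'.
Proof.
have := metric_triangle x x' o; have := metric_triangle x' x y.
rewrite /gromov (metric_sym x' x); lra.
Qed.

Lemma gromov_lipr o x y y' : gromov o x y <= gromov o x y' + mdist y y'.
Proof. by rewrite !(gromov_sym _ x) gromov_lipl. Qed.

Lemma gromov_lip_base o o' x y : gromov o x y <= gromov o' x y + mdist o o'.
Proof.
have := metric_triangle x o' o; have := metric_triangle y o' o.
rewrite /gromov (metric_sym o' o); lra.
Qed.

Lemma gromovC o x y : gromov o x y + gromov x o y = mdist o x.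
Proof. rewrite /gromov (metric_sym y x) (metric_sym y o) (metric_sym x o); lra. Qed.

Lemma gromovxx o x : gromov o x x = mdist x o.
Proof. by rewrite /gromov mdistxx; lra. Qed.

End gromov_product.

Section hyperbolicity.
Context {R : realType} (X : metricType R).

Definition four_point (dl : R) := forall x y z o : X,
  mdist x y + mdist z o <= mdist x z + mdist y o + 2 * dl \/
  mdist x y + mdist z o <= mdist y z + mdist x o + 2 * dl.

(** Bound the right-hand side of strong hyperbolicity by twice its larger term. *)
Lemma CAT_four_point : CAT_m1 X -> four_point (ln 2).
Proof.
move=> Xcat x y z o.
have := CAT_strongly_hyperbolic x y z o Xcat.
have key (a b c : R) : b <= c -> expR (a / 2) <= expR (b / 2) + expR (c / 2) ->
    a <= c + 2 * ln 2.
  move=> bc abc.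
  suff : a / 2 <= ln 2 + c / 2 by lra.
  rewrite -ler_expR expRD lnK ?posrE// mulrDl mul1r (le_trans abc)// lerD2r.
  by rewrite ler_expR ler_pM2r.
have [xz|/ltW yz] := leP (mdist x z + mdist y o) (mdist y z + mdist x o).
  by move=> H; right; exact: key _ _ _ xz H.
by rewrite [leRHS]addrC => H; left; exact: key _ _ _ yz H.
Qed.

Context (dl : R) (dl0 : 0 <= dl) (hyp : four_point dl).

Lemma gromov_hyp (o x y z : X) :
  gromov o x z <= gromov o x y + dl \/ gromov o z y <= gromov o x y + dl.
Proof.
have [H|H] := hyp x y z o; [left|right]; rewrite /gromov; first by lra.
by move: H; rewrite (metric_sym z y); lra.
Qed.

Lemma gromov_hyp_ge (o x y z : X) (t : R) :
  t <= gromov o x z -> t <= gromov o z y -> t - dl <= gromov o x y.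
Proof. by have [] := gromov_hyp o x y z; lra. Qed.

(** [pr] and [ht] play the roles of the coordinate of the projection to a geodesic
from p to q and of the distance to this geodesic. *)
Section projection.
Variables p q : X.
Let pr x := gromov p x q.
Let ht x := gromov x p q.

(** If the projections were further apart than [dl], the four-point condition would
force the way from x to y to pass by the geodesic, at a cost of at least
[ht x + ht y - 2 * dl]. *)
Lemma projection_contracts x y :
  mdist x y < ht x + ht y - 2 * dl -> `|pr x - pr y| <= dl.
Proof.
rewrite ler_norml /pr /ht /gromov => xy.
have := hyp x p y q; have := hyp y p x q.
rewrite ?(metric_sym p q) ?(metric_sym y x) ?(metric_sym p x) ?(metric_sym p y)
  ?(metric_sym q x) ?(metric_sym q y) in xy *.
by move=> [] ? [] ?; apply/andP; split; lra.
Qed.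

Lemma projection_dist x y : mdist x y <= `|pr x - pr y| + ht x + ht y + 2 * dl.
Proof.
have := hyp x y p q.
have := ler_norm (pr x - pr y); have := ler_norm (- (pr x - pr y)); rewrite normrN.
move: (`|_|) => t; rewrite /pr /ht /gromov.
rewrite ?(metric_sym p q) ?(metric_sym y x) ?(metric_sym p x) ?(metric_sym p y)
  ?(metric_sym q x) ?(metric_sym q y).
by move=> ? ? [] ?; lra.
Qed.

End projection.

(** [i] is the time at which the excursion of [e] above the level [D] that
contains the time [k] begins. *)
Lemma excursion_start (e : nat -> R) (n : nat) (D s : R) : e 0%N < D ->
  (forall i, (i < n)%N -> e i.+1 <= e i + s) ->
  forall k, (k <= n)%N -> D <= e k ->
  exists i, [/\ (i <= k)%N, forall m, (i <= m <= k)%N -> D <= e m & e i <= D + s].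
Proof.
move=> e0 es; elim=> [|k IH] kn Dk; first by move: e0; rewrite ltNge Dk.
have [Dek|eDk] := leP D (e k).
  have [i [ik im ei]] := IH (ltnW kn) Dek.
  exists i; split=> // [|m /andP[im' mk]]; first exact: leqW.
  by move: mk; rewrite leq_eqVlt => /orP[/eqP->//|mk]; rewrite im// im'.
exists k.+1; split=> // [m|]; first by rewrite -eqn_leq => /eqP<-.
by rewrite (le_trans (es _ kn))// lerD2r ltW.
Qed.

Definition quasi_geodesic (K : R) (n : nat) (p : nat -> X) :=
  forall i j, (i <= j <= n)%N ->
    (j - i)%:R / K - K <= mdist (p i) (p j) <= K * (j - i)%:R + K.

(** Let pr and ht be as in [projection_contracts], for p 0 and p n. While ht >= D,
jumps of J indices move pr by at most dl each, hence pr moves at speed at most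
dl / J <= 1 / (2 K). A quasi-geodesic moves at speed at least 1 / K, so the
excursion lasts at most a time M, and ht <= D + 2 K + (K M + K) on it. *)
Lemma morse (K : R) : 1 <= K -> exists a : R, forall n p, quasi_geodesic K n p ->
  forall k, (k <= n)%N -> gromov (p k) (p 0%N) (p n) <= a.
Proof.
move=> K1; have dl_ge0 := dl0; have K0 : 0 < K by apply: lt_le_trans K1.
have [J J0 JK] : exists2 J : nat, (0 < J)%N & 2 * dl * K <= J%:R.
  exists (Num.truncn (2 * dl * K)).+1 => //.
  by rewrite ltW// truncnS_gt.
have JR : 0 < J%:R :> R by rewrite ltr0n.
(* Above this height, [projection_contracts] applies to points that are at most
   J indices apart. *)
pose D := (K * J%:R + K) / 2 + dl + 1.
pose M := 2 * K * (5 * K + 2 * D + 3 * dl).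
have D0 : 0 < D.
  have : 0 <= K * J%:R by rewrite mulr_ge0 // ltW.
  by rewrite /D; lra.
exists (Num.max D (D + 2 * K + K * M + K)) => n p pK k kn.
pose e i := gromov (p i) (p 0%N) (p n).
rewrite le_max -[gromov _ _ _]/(e k).
have [//|/ltW Dk] := leP (e k) D; rewrite /=.
have step i : (i < n)%N -> mdist (p i) (p i.+1) <= 2 * K.
  move=> i_n; have /andP[_] := pK i i.+1 (introT andP (conj (leqnSn i) i_n)).
  by rewrite subSnn mulr1; lra.
have e_lip i j : e i <= e j + mdist (p i) (p j) by exact: gromov_lip_base.
have e0 : e 0%N < D by rewrite /e (le_lt_trans (gromov_lel _ _ _))// mdistxx.
have en : e n < D by rewrite /e (le_lt_trans (gromov_ler _ _ _))// mdistxx.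
have [i [ik iD ei]] : exists i, [/\ (i <= k)%N,
    forall m, (i <= m <= k)%N -> D <= e m & e i <= D + 2 * K].
  apply: (excursion_start (n := n)) => // m mn; rewrite (le_trans (e_lip _ m))//.
  by rewrite lerD2l metric_sym step.
(* The end of the excursion is its beginning on the reversed path. *)
have [j [jn kj jD ej]] : exists j, [/\ (j <= n)%N, (k <= j)%N,
    forall m, (k <= m <= j)%N -> D <= e m & e j <= D + 2 * K].
  have [] := @excursion_start (fun i => e (n - i)%N) n D (2 * K) _ _ (n - k)%N.
  - by rewrite subn0.
  - move=> m mn; rewrite (le_trans (e_lip _ (n - m)%N))// lerD2l.
    by rewrite (_ : (n - m = (n - m.+1).+1)%N) ?step//; clear -mn; lia.
  - exact: leq_subr.
  - by rewrite subKn.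
  move=> j [jk jm ej]; exists (n - j)%N; split => //.
  - exact: leq_subr.
  - by clear -jk kn; lia.
  move=> m /andP[km mj]; have := jm (n - m)%N.
  rewrite subKn; last by clear -mj; lia.
  by apply; clear -mj km jk kn; lia.
have eD m : (i <= m <= j)%N -> D <= e m.
  move=> /andP[im mj]; have [mk|km] := leqP m k; first by rewrite iD// im.
  by rewrite jD// mj ltnW.
have slow l m : (i <= l)%N -> (l <= m)%N -> (m <= j)%N ->
    `|gromov (p 0%N) (p l) (p n) - gromov (p 0%N) (p m) (p n)|
      <= dl * ((m - l)%:R / J%:R + 1).
  have [N] := ubnP (m - l)%N; elim: N l => // N IH l lN il lm mj.
  have jump l' : (l <= l' <= m)%N -> (l' - l <= J)%N ->
     `|gromov (p 0%N) (p l) (p n) - gromov (p 0%N) (p l') (p n)| <= dl.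
    move=> /andP[ll' l'm] lJ; apply: projection_contracts.
    have : D <= e l by apply: eD; rewrite il (leq_trans lm mj).
    have : D <= e l' by apply: eD; rewrite (leq_trans il ll') (leq_trans l'm mj).
    have /andP[_] : (l' - l)%:R / K - K <= mdist (p l) (p l') <= K * (l' - l)%:R + K.
      by apply: pK; rewrite ll' (leq_trans (leq_trans l'm mj) jn).
    have : K * (l' - l)%:R <= K * J%:R by rewrite ler_pM2l// ler_nat.
    rewrite -/(e l) -/(e l') /D; lra.
  have [lJ|Jl] := leqP (m - l) J.
    rewrite (le_trans (jump m _ lJ)) ?lm ?leqnn//.
    by rewrite ler_peMr// lerDr divr_ge0.
  have : `|gromov (p 0%N) (p l) (p n) - gromov (p 0%N) (p (l + J)%N) (p n)| <= dl.
    by apply: jump; clear -Jl; lia.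
  have : `|gromov (p 0%N) (p (l + J)%N) (p n) - gromov (p 0%N) (p m) (p n)| <=
      dl * ((m - l)%:R / J%:R).
    have -> : (m - l)%:R / J%:R = (m - (l + J))%:R / J%:R + 1 :> R.
      by rewrite subnDA [in RHS]natrB ?(ltnW Jl)// mulrBl divff ?gt_eqF// subrK.
    by apply: IH => //; clear -lN il Jl J0 lm; lia.
  have := ler_distD (gromov (p 0%N) (p (l + J)%N) (p n))
    (gromov (p 0%N) (p l) (p n)) (gromov (p 0%N) (p m) (p n)).
  by rewrite mulrDr mulr1; lra.
have jiM : (j - i)%:R <= M.
  have /andP[low _] : (j - i)%:R / K - K <= mdist (p i) (p j) <= K * (j - i)%:R + K.
    by apply: pK; rewrite (leq_trans ik kj).
  have up := projection_dist (p 0%N) (p n) (p i) (p j).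
  rewrite -/(e i) -/(e j) in up.
  have sl := slow i j (leqnn _) (leq_trans ik kj) (leqnn _).
  have : dl * ((j - i)%:R / J%:R) <= (j - i)%:R / K / 2.
    rewrite mulrCA -[leRHS]mulrA ler_wpM2l// ler_pdivrMr//.
    have -> : dl = K^-1 / 2 * (2 * dl * K) by field; rewrite gt_eqF.
    by rewrite ler_wpM2l// divr_ge0// invr_ge0 ltW.
  rewrite mulrDr mulr1 in sl => small.
  have : (j - i)%:R / K <= 2 * (5 * K + 2 * D + 3 * dl) by lra.
  by rewrite ler_pdivrMr// /M; lra.
have : e k <= e i + (K * (k - i)%:R + K).
  rewrite (le_trans (e_lip _ i))// lerD2l metric_sym.
  by have /andP[] := pK i k (introT andP (conj ik kn)).
have : K * (k - i)%:R <= K * M.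
  by rewrite ler_pM2l// (le_trans _ jiM)// ler_nat leq_sub2r.
lra.
Qed.

End hyperbolicity.

(** * Orbit paths of reduced words *)
Section words.
Context {r : nat}.
Implicit Types u v w b : seq (letter r).

Definition elt w : free_group r := FreeGroup (reduce_reduced w).

Lemma elt_cat u v : elt (u ++ v) = (elt u * elt v)%g.
Proof. by apply: val_inj; rewrite /= reduce_catl reduce_catr. Qed.

Lemma elt_nil : elt [::] = 1%g. Proof. exact: val_inj. Qed.

Lemma elt_invw w : elt (invw w) = ((elt w)^-1)%g.
Proof.
suff : (elt (invw w) * elt w = 1)%g by move/eqP; rewrite mulg_eq1 => /eqP.
by rewrite -elt_cat; apply: val_inj; rewrite /= reduce_invw_cat.
Qed.

Lemma elt_word (g : free_group r) : elt g = g.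
Proof. by apply: val_inj; rewrite /= reduce_id// fg_reduced. Qed.

Lemma word_length_elt w : reduced w -> word_length (elt w) = size w.
Proof. by move=> rw; rewrite /word_length /= reduce_id. Qed.

Lemma reduced_catl u v : reduced (u ++ v) -> reduced u.
Proof. by case/cat_sorted2. Qed.

Lemma reduced_catr u v : reduced (u ++ v) -> reduced v.
Proof. by case/cat_sorted2. Qed.

Lemma invw_cat u v : invw (u ++ v) = invw v ++ invw u.
Proof. by rewrite /invw map_cat rev_cat. Qed.

Lemma size_invw u : size (invw u) = size u.
Proof. by rewrite /invw size_rev size_map. Qed.

Lemma common_prefix g h : reduced g -> reduced h ->
  exists u g' h', [/\ g = u ++ g', h = u ++ h' & reduced (invw g' ++ h')].
Proof.
elim: g h => [|a g IH] h rg rh.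
  by exists [::], [::], h.
case: h rh => [|c h] rh.
  by exists [::], (a :: g), [::]; split=> //; rewrite cats0; exact: invw_reduced.
have [ac|ac] := eqVneq a c; last first.
  exists [::], (a :: g), (c :: h); split => //.
  have H := invw_reduced rg; rewrite /invw /= rev_cons -cats1 in H *.
  rewrite -catA /= /reduced sorted_cat_cons -cats1; apply/andP; split; first exact: H.
  by rewrite /= invlK eq_sym ac.
subst c; have [||u [g' [h' [gE hE gh]]]] := IH h.
- exact: (reduced_catr (u := [:: a]) rg).
- exact: (reduced_catr (u := [:: a]) rh).
by exists (a :: u), g', h'; rewrite gE hE.
Qed.

End words.

Section orbit.
Context {R : realType} {X : metricType R} (o : X) {r : nat}.
Implicit Types (rho : representation r X) (u v w b : seq (letter r)).

Definition orbit_point rho w : X := rho (elt w) o.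

Lemma representation1 rho x : rho 1%g x = x.
Proof.
apply: mdist_positivity; rewrite -(isometry_mdist (rho 1%g)).
have -> : rho 1%g (rho 1%g x) = rho (1 * 1)%g x by rewrite gmulfM.
by rewrite mulg1 mdistxx.
Qed.

Lemma orbit_point_nil rho : orbit_point rho [::] = o.
Proof. by rewrite /orbit_point elt_nil representation1. Qed.

Lemma orbit_point_cat rho u v :
  orbit_point rho (u ++ v) = rho (elt u) (orbit_point rho v).
Proof. by rewrite /orbit_point elt_cat gmulfM. Qed.

Lemma mdist_orbit_cat rho u v w :
  mdist (orbit_point rho (u ++ v)) (orbit_point rho (u ++ w)) =
  mdist (orbit_point rho v) (orbit_point rho w).
Proof. by rewrite !orbit_point_cat isometry_mdist. Qed.

Lemma mdist_orbit_catl rho u v :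
  mdist (orbit_point rho u) (orbit_point rho (u ++ v)) = mdist o (orbit_point rho v).
Proof. by rewrite -{1}[u]cats0 mdist_orbit_cat orbit_point_nil. Qed.

Lemma mdist_orbit_invw rho u v :
  mdist (orbit_point rho (invw u)) (orbit_point rho v) = mdist o (orbit_point rho (u ++ v)).
Proof.
rewrite -(mdist_orbit_cat rho u) -[in RHS](orbit_point_nil rho); congr mdist.
by rewrite /orbit_point elt_cat elt_invw elt_nil mulgV.
Qed.

Lemma gromov_orbit_cat rho u v w :
  gromov (orbit_point rho u) (orbit_point rho (u ++ v)) (orbit_point rho (u ++ w)) =
  gromov o (orbit_point rho v) (orbit_point rho w).
Proof.
by rewrite /gromov mdist_orbit_cat !(metric_sym _ (orbit_point rho u)) !mdist_orbit_catl
  !(metric_sym o).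
Qed.

(** Both sides measure how much the path from o through [u o] to [u v o] turns back
at [u o]; the right-hand side is that turn carried to o by the inverse of u. *)
Lemma gromov_orbit_turn rho u v :
  gromov (orbit_point rho u) o (orbit_point rho (u ++ v)) =
  gromov o (orbit_point rho (invw u)) (orbit_point rho v).
Proof.
have E : mdist (orbit_point rho (invw u)) o = mdist o (orbit_point rho u).
  by rewrite -[X in mdist _ X](orbit_point_nil rho) mdist_orbit_invw cats0.
rewrite /gromov mdist_orbit_invw E (metric_sym (orbit_point rho (u ++ v))).
by rewrite mdist_orbit_catl (metric_sym (orbit_point rho v)).
Qed.

Lemma mdist_orbit_add rho u v : mdist o (orbit_point rho (u ++ v)) =
  mdist o (orbit_point rho u) + mdist o (orbit_point rho v)
  - 2 * gromov o (orbit_point rho (invw u)) (orbit_point rho v).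
Proof.
rewrite -gromov_orbit_turn /gromov.
rewrite (metric_sym (orbit_point rho (u ++ v))) mdist_orbit_catl; lra.
Qed.

(** By [gromov_orbit_turn], orbit paths of reduced words turn back by at most [a]
at each of their points. *)
Definition bounded_turn rho (a : R) := forall u v, reduced (u ++ v) ->
  gromov o (orbit_point rho (invw u)) (orbit_point rho v) <= a.

Definition orbit_schottky rho (K : R) := forall w, reduced w ->
  (size w)%:R / K - K <= mdist o (orbit_point rho w) <= K * (size w)%:R + K.

Lemma schottky_orbit rho : schottky o rho -> exists2 K : R, 1 <= K & orbit_schottky rho K.
Proof.
move=> [K K1 H]; exists K => // w rw.
have := H (elt [::]) (elt w); rewrite -!/(orbit_point _ _) orbit_point_nil /=.
by rewrite elt_nil invg1 mul1g word_length_elt.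
Qed.

(** The prefixes of a reduced word form a quasi-geodesic. *)
Lemma schottky_bounded_turn (dl : R) rho (K : R) : 0 <= dl -> four_point X dl ->
  1 <= K -> orbit_schottky rho K -> exists a, bounded_turn rho a.
Proof.
move=> dl0 hyp K1 sch; have [a Ha] := morse dl0 hyp K1; exists a => u v ruv.
pose w := u ++ v; pose p i := orbit_point rho (take i w).
have := Ha (size w) p _ (size u) _.
rewrite /p take0 orbit_point_nil take_size take_size_cat// gromov_orbit_turn.
apply; last by rewrite size_cat leq_addr.
move=> i j /andP[ij jw].
have E : take j w = take i w ++ drop i (take j w).
  by rewrite -{1}(cat_take_drop i (take j w)) take_takel.
have sE : size (drop i (take j w)) = (j - i)%N by rewrite size_drop size_takel.
rewrite /p E mdist_orbit_catl -sE; apply: sch.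
exact/drop_sorted/take_sorted.
Qed.

(** * From blocks to words *)

(** If blocks of N letters are long compared to the turns between adjacent blocks,
then all turns are bounded. *)
Section local_to_global.
Context (dl : R) (dl0 : 0 <= dl) (hyp : four_point X dl).
Context (rho : representation r X) (N : nat) (a l B : R) (N0 : (0 < N)%N).
Hypothesis turn : forall b v, size b = N -> (size v <= N)%N -> reduced (b ++ v) ->
  gromov o (orbit_point rho (invw b)) (orbit_point rho v) <= a.
Hypothesis long : forall b, size b = N -> reduced b -> l <= mdist o (orbit_point rho b).
Hypothesis short : forall v, (size v <= N)%N -> reduced v -> mdist o (orbit_point rho v) <= B.
Hypothesis la : 2 * a + 3 * dl < l.

(** Induction on [v], with first block [b1]. By induction the path of [v] turns
little after [b1], so the Gromov product of [b1 o] and [v o] at o is close to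
the length of [b1], which exceeds the turn from [b] to [b1]. By the four-point
condition the turn from [b] to [v] is the one from [b] to [b1], up to [dl]. *)
Lemma block_turn b v : size b = N -> reduced (b ++ v) ->
  gromov o (orbit_point rho (invw b)) (orbit_point rho v) <= a + dl.
Proof.
have [la_ dl0_] := (la, dl0).
have [n] := ubnP (size v); elim: n b v => // n IH b v vn bN rbv.
have [vN|Nv] := leqP (size v) N.
  by rewrite (le_trans (turn bN vN rbv))// lerDl.
rewrite -(cat_take_drop N v) in rbv *.
set b1 := take N v in rbv *; set v1 := drop N v in rbv *.
have b1N : size b1 = N by rewrite size_takel// ltnW.
have v1n : (size v1 < n)%N by rewrite size_drop; clear -vn Nv N0; lia.
have := IH b1 v1 v1n b1N (reduced_catr rbv).
rewrite -gromov_orbit_turn => IH1.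
have := gromovC o (orbit_point rho b1) (orbit_point rho (b1 ++ v1)).
have := long b1N (reduced_catl (reduced_catr rbv)).
rewrite catA in rbv.
have b1le : (size b1 <= N)%N by rewrite b1N.
have := turn bN b1le (reduced_catl rbv).
have := gromov_hyp hyp o (orbit_point rho (invw b)) (orbit_point rho b1)
  (orbit_point rho (b1 ++ v1)).
rewrite [X in _ \/ X <= _]gromov_sym.
by move=> [] ? ? ? ?; lra.
Qed.

Lemma block_turn_rev u b : size b = N -> reduced (u ++ b) ->
  gromov o (orbit_point rho (invw u)) (orbit_point rho b) <= a + dl.
Proof.
move=> bN rub; rewrite gromov_sym -{1}(invwK b); apply: block_turn.
  by rewrite size_invw.
by rewrite -invw_cat invw_reduced.
Qed.

(** A word [v] shorter than a block turns back by at most its orbit length, hence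
by at most [B]. *)
Lemma global_turn : bounded_turn rho (Num.max (a + 2 * dl) B).
Proof.
have [la_ dl0_] := (la, dl0).
move=> u v ruv; rewrite le_max; have [vN|Nv] := leqP (size v) N.
  apply/orP; right; apply: le_trans (gromov_ler _ _ _) _.
  by rewrite short ?(reduced_catr ruv).
apply/orP; left.
rewrite -(cat_take_drop N v) in ruv *.
set b1 := take N v in ruv *; set v1 := drop N v in ruv *.
have b1N : size b1 = N by rewrite size_takel// ltnW.
have := block_turn b1N (reduced_catr ruv).
rewrite -gromov_orbit_turn => IH1.
have := gromovC o (orbit_point rho b1) (orbit_point rho (b1 ++ v1)).
have := long b1N (reduced_catl (reduced_catr ruv)).
rewrite catA in ruv.
have := block_turn_rev b1N (reduced_catl ruv).
have := gromov_hyp hyp o (orbit_point rho (invw u)) (orbit_point rho b1)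
  (orbit_point rho (b1 ++ v1)).
rewrite [X in _ \/ X <= _]gromov_sym.
by move=> [] ? ? ? ?; lra.
Qed.

End local_to_global.

(** Cutting off one block changes the difference of the orbit lengths by at most
1 + 2 c, and decreases the length for [rho'] by at least l - 2 c; by assumption
[e] times the decrease makes up for the change. *)
Lemma orbit_length_close rho rho' (N : nat) (c l e : R) : (0 < N)%N -> 0 <= e ->
  (forall b v, size b = N -> reduced (b ++ v) ->
     gromov o (orbit_point rho (invw b)) (orbit_point rho v) <= c) ->
  (forall b v, size b = N -> reduced (b ++ v) ->
     gromov o (orbit_point rho' (invw b)) (orbit_point rho' v) <= c) ->
  (forall b, size b = N -> reduced b -> l <= mdist o (orbit_point rho' b)) ->
  (forall v, (size v <= N)%N -> reduced v ->
     `|mdist o (orbit_point rho v) - mdist o (orbit_point rho' v)| <= 1) ->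
  1 + 2 * c <= e * (l - 2 * c) ->
  forall v, reduced v ->
   `|mdist o (orbit_point rho v) - mdist o (orbit_point rho' v)|
      <= e * mdist o (orbit_point rho' v) + 1.
Proof.
move=> N0 e0 t t' long close ce v.
have [n] := ubnP (size v); elim: n v => // n IH v vn rv.
have [vN|Nv] := leqP (size v) N.
  by rewrite (le_trans (close _ vN rv))// lerDr mulr_ge0 ?mdist_ge0.
rewrite -(cat_take_drop N v) in rv *.
set b := take N v in rv *; set v1 := drop N v in rv *.
have bN : size b = N by rewrite size_takel// ltnW.
have v1n : (size v1 < n)%N by rewrite size_drop; clear -vn Nv N0; lia.
have ble : (size b <= N)%N by rewrite bN.
have IH1 := IH v1 v1n (reduced_catr rv).
have c1 := close b ble (reduced_catl rv).
have l1 := long b bN (reduced_catl rv).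
rewrite !mdist_orbit_add.
have g1 := t b v1 bN rv; have g1' := t' b v1 bN rv.
have := gromov_ge0 o (orbit_point rho (invw b)) (orbit_point rho v1).
have := gromov_ge0 o (orbit_point rho' (invw b)) (orbit_point rho' v1).
move: g1 g1' IH1 c1 l1; set g := gromov _ _ _; set g' := gromov _ _ _.
move=> g1 g1'; set dv := mdist o (orbit_point rho v1).
set dv' := mdist o (orbit_point rho' v1).
set db := mdist o (orbit_point rho b); set db' := mdist o (orbit_point rho' b).
move=> IH1 c1 l1 g0 g0'.
have : e * (l - 2 * c) <= e * (db' - 2 * g') by rewrite ler_wpM2l//; lra.
have -> : e * (db' + dv' - 2 * g') = e * (db' - 2 * g') + e * dv' by ring.
move: IH1 c1; rewrite !ler_norml => /andP[? ?] /andP[? ?] ?.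
by apply/andP; split; lra.
Qed.

(** The orbit paths of [u g] and [u h] separate at [u o]: three points with
bounded turns at a centre form a tripod up to a constant. *)
Lemma gromov_branch rho (a : R) : bounded_turn rho a -> forall u g h,
  reduced (u ++ g) -> reduced (u ++ h) -> reduced (invw g ++ h) ->
  mdist o (orbit_point rho u) - 2 * a <=
    gromov o (orbit_point rho (u ++ g)) (orbit_point rho (u ++ h))
  <= mdist o (orbit_point rho u) + a.
Proof.
move=> turn u g h rug ruh rgh.
have := turn _ _ rug; have := turn _ _ ruh; have := turn _ _ rgh.
have := gromov_ge0 o (orbit_point rho (invw (invw g))) (orbit_point rho h).
have := gromov_ge0 o (orbit_point rho (invw u)) (orbit_point rho g).
have := gromov_ge0 o (orbit_point rho (invw u)) (orbit_point rho h).
rewrite invwK -(gromov_orbit_cat rho u g h) -!gromov_orbit_turn.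
set x := orbit_point rho (u ++ g); set y := orbit_point rho (u ++ h).
set p := orbit_point rho u.
rewrite /gromov (metric_sym x o) (metric_sym y o).
by move=> *; apply/andP; split; lra.
Qed.

End orbit.

(** * Stability of a Schottky orbit *)
Section stability.
Context {R : realType} (X : metricType R) (o : X) (r : nat).
Variables (rho : nat -> representation r X) (rho_oo : representation r X).
Hypothesis cvg_orbit : forall g : free_group r, rho k g o @[k --> \oo] --> rho_oo g o.

Local Notation tau k w := (orbit_point o (rho k) w).
Local Notation tau_oo w := (orbit_point o rho_oo w).

Lemma orbit_cvg_short (n : nat) (e : R) : 0 < e ->
  \forall k \near \oo, forall w, (size w <= n)%N -> mdist (tau_oo w) (tau k w) <= e.
Proof.
move=> e0.
have H : \forall k \near \oo, forall i : 'I_n.+1, forall w : i.-tuple ('I_r * bool)%type,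
    mdist (tau_oo w) (tau k w) <= e.
  apply: filter_forall => i; apply: filter_forall => w.
  exact: (metricType_numDomainType.cvgr_dist_le (@cvg_orbit (elt w))) e0.
near=> k => w wn.
have wn1 : (size w < n.+1)%N by [].
have /(_ k) Hk := near H _.
by have := Hk _ (Ordinal wn1) (in_tuple w); apply.
Unshelve. all: by end_near. Qed.

Variable dl : R.
Hypothesis dl0 : 0 <= dl.
Hypothesis hyp : four_point X dl.
Hypothesis sch : schottky o rho_oo.

(** The length N of blocks is chosen first, from the constants of the limit
representation and from [e]; then k is large enough for the orbit points of the
words of at most N letters to have almost converged. *)
Lemma stability (e : R) : 0 < e -> exists A, \forall k \near \oo,
  bounded_turn o (rho k) A /\
  forall v, reduced v ->
    `|mdist o (tau k v) - mdist o (tau_oo v)| <= e * mdist o (tau_oo v) + 1.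
Proof.
move=> e0; have dl_ge0 := dl0.
have [K K1 schK] := schottky_orbit sch.
have K0 : 0 < K by apply: lt_le_trans K1.
have [a0 turn0] := schottky_bounded_turn dl0 hyp K1 schK.
have a00 : 0 <= a0 by apply: le_trans (turn0 [::] [::] isT); exact: gromov_ge0.
pose a := a0 + 1; pose c := a + dl.
(* A lower bound for the length of a block that meets the conditions of
   [global_turn] and of [orbit_length_close]. *)
pose l := 2 * c + (1 + 2 * c) / e + dl + 1.
have c0 : 0 <= c by rewrite /c /a; lra.
have [N N0 Nl] : exists2 N : nat, (0 < N)%N & l + 1 + K <= N%:R / K.
  exists (Num.truncn ((l + 1 + K) * K)).+1 => //.
  by rewrite ler_pdivlMr// ltW// truncnS_gt.
have ce : 1 + 2 * c <= e * (l - 2 * c).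
  rewrite -ler_pdivrMl// mulrC /l; set t := _ / e; lra.
have la : 2 * a + 3 * dl < l.
  have : 0 <= (1 + 2 * c) / e by rewrite divr_ge0 ?(ltW e0)//; lra.
  by rewrite /l; set t := _ / e; rewrite /c; lra.
pose B := K * N%:R + K + 1.
exists (Num.max (a + 2 * dl) B).
have H := @orbit_cvg_short N (1 / 2) (divr_gt0 ltr01 (ltr0n _ 2)).
near=> k.
have Hk : forall w, (size w <= N)%N -> mdist (tau_oo w) (tau k w) <= 1 / 2 by near: k.
have Hd w : (size w <= N)%N -> `|mdist o (tau k w) - mdist o (tau_oo w)| <= 1 / 2.
  move=> wN; have := Hk w wN; rewrite ler_norml.
  have := metric_triangle o (tau k w) (tau_oo w).
  have := metric_triangle o (tau_oo w) (tau k w).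
  by rewrite (metric_sym (tau k w)) => *; apply/andP; split; lra.
have long_oo b : size b = N -> reduced b -> l + 1 <= mdist o (tau_oo b).
  by move=> bN rb; have /andP[+ _] := schK b rb; rewrite bN; lra.
have turnk b v : size b = N -> (size v <= N)%N -> reduced (b ++ v) ->
    gromov o (tau k (invw b)) (tau k v) <= a.
  move=> bN vN rbv; have := turn0 b v rbv.
  have := gromov_lipl o (tau k (invw b)) (tau_oo (invw b)) (tau k v).
  have := gromov_lipr o (tau_oo (invw b)) (tau k v) (tau_oo v).
  have := Hk (invw b); rewrite size_invw bN leqnn => /(_ isT); have := Hk v vN.
  by rewrite !(metric_sym (tau k _)) /a; lra.
have longk b : size b = N -> reduced b -> l <= mdist o (tau k b).
  move=> bN rb; have := long_oo b bN rb; have := Hd b.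
  by rewrite bN leqnn ler_norml => /(_ isT) /andP[]; lra.
have shortk v : (size v <= N)%N -> reduced v -> mdist o (tau k v) <= B.
  move=> vN rv; have /andP[_] := schK v rv; have := Hd v vN.
  have : K * (size v)%:R <= K * N%:R by rewrite ler_pM2l// ler_nat.
  by rewrite ler_norml /B => ? /andP[]; lra.
split; first exact: (global_turn dl0 hyp N0 turnk longk shortk la).
apply: (@orbit_length_close _ _ _ _ _ _ N c l e N0 (ltW e0)) => //.
- exact: (block_turn dl0 hyp N0 turnk longk la).
- by move=> b v _ /turn0; rewrite /c /a; lra.
- by move=> b bN rb; have := long_oo b bN rb; lra.
- by move=> v vN rv; have := Hd v vN; lra.
Unshelve. all: by end_near. Qed.

Lemma schottky_turn : exists a, bounded_turn o rho_oo a.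
Proof.
have [K K1 schK] := schottky_orbit sch.
exact: schottky_bounded_turn dl0 hyp K1 schK.
Qed.

Lemma gromov_orbit_close (e : R) : 0 < e -> exists C, \forall k \near \oo,
  forall g h : free_group r,
  `|gromov o (rho k g o) (rho k h o) - gromov o (rho_oo g o) (rho_oo h o)|
    <= e * gromov o (rho_oo g o) (rho_oo h o) + C.
Proof.
move=> e0; have [A H] := stability e0; have [a turn] := schottky_turn.
exists (2 * a * e + 1 + 2 * a + 2 * A + a + A).
near=> k => g h.
have [turnk close] : bounded_turn o (rho k) A /\
  forall v, reduced v ->
    `|mdist o (tau k v) - mdist o (tau_oo v)| <= e * mdist o (tau_oo v) + 1 by near: k.
have [u [g' [h' [gE hE gh]]]] := common_prefix (fg_reduced g) (fg_reduced h).
have rug : reduced (u ++ g') by rewrite -gE fg_reduced.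
have ruh : reduced (u ++ h') by rewrite -hE fg_reduced.
have := gromov_branch turn rug ruh gh; have := gromov_branch turnk rug ruh gh.
have := close u (reduced_catl rug).
rewrite /orbit_point -gE -hE !elt_word.
set G := gromov _ _ _; set Goo := gromov _ _ _.
set dk := mdist o _; set doo := mdist o _.
rewrite !ler_norml => /andP[? ?] /andP[? ?] /andP[? ?].
have a0 : 0 <= a by apply: le_trans (turn [::] [::] isT); exact: gromov_ge0.
have A0 : 0 <= A by apply: le_trans (turnk [::] [::] isT); exact: gromov_ge0.
have : e * doo <= e * (Goo + 2 * a) by rewrite ler_pM2l//; lra.
rewrite mulrDr mulrCA => ?.
by apply/andP; split; lra.
Unshelve. all: by end_near. Qed.

(** The prefix u of L letters of g joins the two points: R_k(g) o is seen from o in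
the direction of R_k(u) o, which is close to R_oo(u) o for large k, and this point
is in the direction of R_oo(g) o. *)
Lemma gromov_orbit_large (M : R) : exists L : nat, \forall k \near \oo,
  forall g : free_group r, (L <= word_length g)%N -> M <= gromov o (rho k g o) (rho_oo g o).
Proof.
have dl_ge0 := dl0.
have [A H] := stability ltr01; have [a turn] := schottky_turn.
have [K K1 schK] := schottky_orbit sch.
have K0 : 0 < K by apply: lt_le_trans K1.
have [L LM] : exists L : nat, M + 2 * dl + 1 + Num.max 0 (Num.max a A) + K <= L%:R / K.
  exists (Num.truncn ((M + 2 * dl + 1 + Num.max 0 (Num.max a A) + K) * K)).+1.
  by rewrite ler_pdivlMr// ltW// truncnS_gt.
exists L.
have HL := @orbit_cvg_short L 1 ltr01.
near=> k => g Lg.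
have [turnk _] : bounded_turn o (rho k) A /\
  forall v, reduced v ->
    `|mdist o (tau k v) - mdist o (tau_oo v)| <= 1 * mdist o (tau_oo v) + 1 by near: k.
have Hk : forall w, (size w <= L)%N -> mdist (tau_oo w) (tau k w) <= 1 by near: k.
pose u := take L g; pose v := drop L g.
have gE : u ++ v = g by rewrite cat_take_drop.
have ruv : reduced (u ++ v) by rewrite gE fg_reduced.
have uL : size u = L by rewrite size_takel.
have := Hk u; rewrite uL leqnn => /(_ isT) Hu.
have := turn u v ruv; rewrite -gromov_orbit_turn gE {2}/orbit_point elt_word => t_oo.
have := turnk u v ruv; rewrite -gromov_orbit_turn gE {2}/orbit_point elt_word => t_k.
have /andP[du _] := schK u (reduced_catl ruv); rewrite uL in du.
have c_oo := gromovC o (tau_oo u) (rho_oo g o).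
have c_k := gromovC o (tau k u) (rho k g o).
pose t := L%:R / K - K - 1 - Num.max 0 (Num.max a A).
have : t <= gromov o (tau_oo u) (rho_oo g o).
  have : a <= Num.max 0 (Num.max a A) by rewrite !le_max lexx !orbT.
  by rewrite /t; lra.
have dku : mdist o (tau_oo u) <= mdist o (tau k u) + 1.
  have := metric_triangle o (tau k u) (tau_oo u).
  by rewrite (metric_sym (tau k u)); lra.
have : t <= gromov o (tau k u) (rho k g o).
  have : A <= Num.max 0 (Num.max a A) by rewrite !le_max lexx !orbT.
  by rewrite /t; lra.
have : t <= gromov o (tau k u) (tau_oo u).
  have := gromov_lipl o (tau_oo u) (tau k u) (tau_oo u).
  rewrite gromovxx (metric_sym _ o).
  have : 0 <= Num.max 0 (Num.max a A) by rewrite le_max lexx.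
  by rewrite /t; lra.
rewrite [gromov o _ (rho k g o)]gromov_sym => t1 t2 t3.
have t12 := gromov_hyp_ge hyp t2 t1.
have t3' : t - dl <= gromov o (tau_oo u) (rho_oo g o) by lra.
have := gromov_hyp_ge hyp t12 t3'.
by rewrite /t; lra.
Unshelve. all: by end_near. Qed.

Lemma schottky_word_length (M : nat) : exists B : R, forall g : free_group r,
  B <= mdist o (rho_oo g o) -> (M <= word_length g)%N.
Proof.
have [K K1 schK] := schottky_orbit sch.
have K0 : 0 < K by apply: lt_le_trans K1.
exists (K * M%:R + K + 1) => g Bg; rewrite leqNgt; apply/negP => gM.
have /andP[_] := schK g (fg_reduced g); rewrite /orbit_point elt_word.
have : K * (size (fg_word g))%:R <= K * M%:R by rewrite ler_pM2l// ler_nat ltnW.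
lra.
Qed.

End stability.

(** * The visual distance *)
Lemma near_pairP (P : set (nat * nat)) :
  (\forall nm \near (\oo, \oo), P nm) <->
  exists N, forall n m, (N <= n)%N -> (N <= m)%N -> P (n, m).
Proof.
split=> [[[A B] /= [[a _ aA] [b _ bB]] AB]|[N NP]].
  exists (maxn a b) => n m; rewrite !geq_max => /andP[an _] /andP[_ bm].
  by apply: AB; split; [exact: aA|exact: bB].
exists ([set n | (N <= n)%N], [set n | (N <= n)%N]).
  by split; exists N.
by move=> [n m] [/= ? ?]; exact: NP.
Qed.

Section boundary_distance.
Context {R : realType} (X : metricType R) (o : X).
Implicit Types (u v : nat -> X) (xi zeta : boundary o).

Local Notation D x y := (expR (- gromov o x y)).

Lemma gromov_seqP u : gromov_seq o u <->
  forall A, exists N, forall n m, (N <= n)%N -> (N <= m)%N -> A <= gromov o (u n) (u m).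
Proof.
rewrite /gromov_seq; split=> [/cvgryPge H A|H].
  by have /near_pairP := H A.
by apply/cvgryPge => A; apply/near_pairP; exact: H.
Qed.

Lemma gromov_equivP u v : gromov_equiv o u v <->
  forall A, exists N, forall n, (N <= n)%N -> A <= gromov o (u n) (v n).
Proof.
rewrite /gromov_equiv; split=> [/cvgryPge H A|H].
  by have [N _ NP] := H A; exists N.
by apply/cvgryPge => A; have [N NP] := H A; exists N.
Qed.

Lemma gromov_seq_equiv u : gromov_seq o u -> gromov_equiv o u u.
Proof.
move=> /gromov_seqP H; apply/gromov_equivP => A.
by have [N NP] := H A; exists N => n Nn; exact: NP.
Qed.

Lemma boundary_exists u : gromov_seq o u -> exists xi : boundary o, bd_class xi u.
Proof.
move=> ug.
have P : exists2 w, gromov_seq o w &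
  [set v | gromov_seq o v /\ gromov_equiv o u v] =
  [set v | gromov_seq o v /\ gromov_equiv o w v].
  by exists u.
by exists (Boundary P); split=> //; exact: gromov_seq_equiv.
Qed.

Lemma boundary_seq xi u : bd_class xi u -> gromov_seq o u.
Proof. by have [w _ ->] := bd_classP xi; case. Qed.

Hypothesis tri : forall x y z, D x y <= D x z + D z y.

Lemma gromov_large_D (e : R) x y : 0 < e -> - ln e <= gromov o x y -> D x y <= e.
Proof. by move=> e0 H; rewrite -[leRHS]lnK ?posrE// ler_expR; lra. Qed.

(** Representatives of the same boundary point are close for D, even at different
times. *)
Lemma gromov_mixed xi u v : bd_class xi u -> bd_class xi v ->
  forall e, 0 < e -> exists N, forall n m, (N <= n)%N -> (N <= m)%N -> D (u n) (v m) <= e.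
Proof.
have [w wg ->] := bd_classP xi => -[ug uw] [vg vw] e e0.
have e3 : 0 < e / 3 by rewrite divr_gt0.
have [a Ha] := (gromov_equivP _ _).1 uw (- ln (e / 3)).
have [b Hb] := (gromov_equivP _ _).1 vw (- ln (e / 3)).
have [c Hc] := (gromov_seqP _).1 wg (- ln (e / 3)).
exists (maxn a (maxn b c)) => n m; rewrite !geq_max => /and3P[an _ cn] /and3P[_ bm cm].
have := tri (u n) (v m) (w n); have := tri (w n) (v m) (w m).
have := gromov_large_D e3 (Ha n an); have := gromov_large_D e3 (Hb m bm).
by have := gromov_large_D e3 (Hc n m cn cm); rewrite (gromov_sym o (u n) (w n)); lra.
Qed.

(** By the triangle inequality D is Cauchy along pairs of representatives, with a
limit t that does not depend on them. Then the Gromov products converge to - ln t,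
or to +oo if t = 0, which identifies the value of [gromov_bd]. *)
Lemma visual_cvg xi zeta u v : bd_class xi u -> bd_class zeta v ->
  D (u nm.1) (v nm.2) @[nm --> (\oo, \oo)] --> visual_dist o xi zeta.
Proof.
move=> xu zv.
have close u1 u2 v1 v2 : bd_class xi u1 -> bd_class xi u2 ->
    bd_class zeta v1 -> bd_class zeta v2 -> forall e, 0 < e -> exists N, forall n m n' m',
    (N <= n)%N -> (N <= m)%N -> (N <= n')%N -> (N <= m')%N ->
    `|D (u1 n) (v1 m) - D (u2 n') (v2 m')| <= e.
  move=> xu1 xu2 zv1 zv2 e e0.
  have e2 : 0 < e / 2 by rewrite divr_gt0.
  have [N1 H1] := gromov_mixed xu1 xu2 e2; have [N2 H2] := gromov_mixed zv1 zv2 e2.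
  exists (maxn N1 N2) => n m n' m'; rewrite !geq_max.
  move=> /andP[n1 _] /andP[_ m2] /andP[n'1 _] /andP[_ m'2].
  have := H1 _ _ n1 n'1; have := H2 _ _ m2 m'2.
  have := tri (u1 n) (v1 m) (u2 n'); have := tri (u2 n') (v1 m) (v2 m').
  have := tri (u2 n') (v2 m') (u1 n); have := tri (u1 n) (v2 m') (v1 m).
  rewrite (gromov_sym o (u2 n') (u1 n)) (gromov_sym o (v2 m') (v1 m)) ler_norml.
  by move=> *; apply/andP; split; lra.
have [t ft] : exists t : R, D (u nm.1) (v nm.2) @[nm --> (\oo, \oo)] --> t.
  suff /cvg_ex : cvg (D (u nm.1) (v nm.2) @[nm --> (\oo, \oo)]) by [].
  apply/cauchy_cvgP/cauchy_exP => e e0.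
  have e2 : 0 < e / 2 by rewrite divr_gt0.
  have [N HN] := close _ _ _ _ xu xu zv zv _ e2.
  exists (D (u N) (v N)); apply/near_pairP; exists N => n m Nn Nm /=.
  by rewrite /ball /= (le_lt_trans (HN _ _ _ _ _ _ _ _))//; lra.
have limt u' v' : bd_class xi u' -> bd_class zeta v' ->
    D (u' nm.1) (v' nm.2) @[nm --> (\oo, \oo)] --> t.
  move=> xu' zv'; apply/cvgrPdist_le => e e0.
  have e2 : 0 < e / 2 by rewrite divr_gt0.
  have [N HN] := close _ _ _ _ xu xu' zv zv' _ e2.
  have /cvgrPdist_le /(_ _ e2) /near_pairP[M HM] := ft.
  apply/near_pairP; exists (maxn N M) => n m; rewrite !geq_max.
  move=> /andP[Nn Mn] /andP[Nm Mm] /=.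
  have := HM n m Mn Mm; have := HN n m n m Nn Nm Nn Nm => /=.
  have := ler_distD (D (u n) (v m)) t (D (u' n) (v' m)); lra.
suff -> : visual_dist o xi zeta = t by [].
have t0 : 0 <= t by apply: (cvgr_to_ge ft); near=> nm; rewrite expR_ge0.
pose l : \bar R := if t == 0 then +oo%E else (- ln t)%:E.
have liml u' v' : bd_class xi u' -> bd_class zeta v' ->
    (gromov o (u' nm.1) (v' nm.2))%:E @[nm --> (\oo, \oo)] --> l.
  move=> xu' zv'; have lt := limt _ _ xu' zv'; rewrite /l; case: eqVneq => [tE|tn].
    apply/cvgeyPge => A; rewrite tE in lt.
    have /cvgrPdist_le /(_ _ (expR_gt0 (- A))) := lt.
    apply: filterS => nm; rewrite sub0r normrN ger0_norm ?expR_ge0// ler_expR lee_fin; lra.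
  have tp : 0 < t by rewrite lt_neqAle eq_sym tn.
  apply: cvg_EFin; first by near=> nm.
  have -> : fine \o (fun nm : nat * nat => (gromov o (u' nm.1) (v' nm.2))%:E) =
      (fun nm => - ln (D (u' nm.1) (v' nm.2))).
    by apply/funext => nm /=; rewrite expRK opprK.
  apply: cvgN; apply: (cvg_comp _ _ lt); exact: continuous_ln.
have /getPex H : exists l : \bar R, forall u' v', bd_class xi u' -> bd_class zeta v' ->
    (gromov o (u' nm.1) (v' nm.2))%:E @[nm --> (\oo, \oo)] --> l by exists l.
have lE : gromov_bd o xi zeta = l.
  by apply: (cvg_unique (@ereal_hausdorff R) (H _ _ xu zv)); exact: liml.
rewrite /visual_dist lE /l; case: eqVneq => [->//|tn] /=.
by rewrite opprK lnK// posrE lt_neqAle eq_sym tn.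
Unshelve. all: by end_near. Qed.

Lemma visual_ge0 xi zeta : 0 <= visual_dist o xi zeta.
Proof. by rewrite /visual_dist fine_ge0// expeR_ge0. Qed.

Lemma visual_le (e : R) xi zeta u v : bd_class xi u -> bd_class zeta v -> 0 < e ->
  (exists N, forall n, (N <= n)%N -> - ln e <= gromov o (u n) (v n)) ->
  visual_dist o xi zeta <= e.
Proof.
move=> xu zv e0 [N HN]; have := visual_cvg xu zv.
move=> /cvgrPdist_le H; apply/ler_addgt0Pr => d d0.
have /near_pairP[M HM] := H _ d0.
have := HM (maxn N M) (maxn N M) (leq_maxr _ _) (leq_maxr _ _) => /=.
have := gromov_large_D e0 (HN (maxn N M) (leq_maxl _ _)).
by rewrite ler_norml => ? /andP[]; lra.
Qed.

(** An affine lower bound for Gromov products becomes a Hoelder estimate for their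
exponentials. *)
Lemma visual_holder (s C : R) xi zeta xi' zeta' u v u' v' : 0 < s ->
  bd_class xi u -> bd_class zeta v -> bd_class xi' u' -> bd_class zeta' v' ->
  (forall n m, s * gromov o (u n) (v m) - C <= gromov o (u' n) (v' m)) ->
  visual_dist o xi' zeta' <= expR C * visual_dist o xi zeta `^ s.
Proof.
move=> s0 xu zv xu' zv' H.
have l1 := visual_cvg xu zv; have l2 := visual_cvg xu' zv'.
have [tE|tn] := eqVneq (visual_dist o xi zeta) 0.
  rewrite tE powR0 ?gt_eqF// mulr0; rewrite tE in l1.
  apply/ler_addgt0Pr => e e0; rewrite add0r.
  apply: (cvgr_to_le l2).
  have /cvgrPdist_le /(_ _ (expR_gt0 ((ln e - C) / s))) := l1.
  apply: filterS => -[n m] /=; rewrite sub0r normrN ger0_norm ?expR_ge0// ler_expR => g.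
  apply: gromov_large_D => //; apply: le_trans (H n m).
  by move: g; rewrite ler_pdivlMr// mulrC mulrN; lra.
have tp : 0 < visual_dist o xi zeta by rewrite lt_neqAle eq_sym tn visual_ge0.
have l3 : expR (C + s * ln (D (u nm.1) (v nm.2))) @[nm --> (\oo, \oo)] -->
    expR C * visual_dist o xi zeta `^ s.
  rewrite /powR (negbTE tn) -expRD.
  apply: continuous_cvg; first exact: continuous_expR.
  apply: cvgD; first exact: cvg_cst.
  apply: cvgMr; apply: (cvg_comp _ _ l1); exact: continuous_ln.
apply: (ler_cvg_to l2 l3).
near=> nm; rewrite expRK ler_expR; have := H nm.1 nm.2; lra.
Unshelve. all: by end_near. Qed.

End boundary_distance.

(** Strong hyperbolicity divided by exp((xo + yo + zo)/2). *)
Lemma CAT_visual_triangle (R : realType) (X : metricType R) (o : X) : CAT_m1 X ->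
  forall x y z : X, expR (- gromov o x y) <= expR (- gromov o x z) + expR (- gromov o z y).
Proof.
move=> Xcat x y z; have := CAT_strongly_hyperbolic x y z o Xcat.
set t := expR ((mdist x o + mdist y o + mdist z o) / 2) => H.
have t0 : 0 < t by apply: expR_gt0.
rewrite -(ler_pM2r t0) mulrDl /t -!expRD; move: H; congr (is_true (_ <= _ + _)); congr expR;
  rewrite /gromov ?(metric_sym z y); lra.
Qed.

(** * Hausdorff dimension and Hoelder correspondences *)
Section hausdorff_dimension.
Local Open Scope ereal_scope.
Context {R : realType}.

Lemma diam_pow_ge0 (T : Type) (d : T -> T -> R) s U : 0 <= diam_pow d s U.
Proof. by rewrite /diam_pow; case: ifP => // _; exact: poweR_ge0. Qed.

Lemma hausdorff_content_ge0 (T : Type) (d : T -> T -> R) s e A :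
  0 <= hausdorff_content d s e A.
Proof.
apply: le_ereal_inf_tmp => _ [U _ <-]; apply: nneseries_ge0 => i _ _.
exact: diam_pow_ge0.
Qed.

Lemma hausdorff_measure_eq0 (T : Type) (d : T -> T -> R) s A :
  hausdorff_measure d s A = 0 <-> forall e, (0 < e)%R -> hausdorff_content d s e A <= 0.
Proof.
split=> [<- e e0|H]; first by apply: ereal_sup_ubound; exists e.
apply/eqP; rewrite eq_le; apply/andP; split.
  by apply: ge_ereal_sup => _ [e e0 <-]; exact: H.
apply: le_trans (hausdorff_content_ge0 d s 1 A) _.
by apply: ereal_sup_ubound; exists 1%R => //=.
Qed.

Lemma Hdim_ge0 (T : Type) (d : T -> T -> R) A : 0 <= Hdim d A.
Proof. by apply: le_ereal_inf_tmp => _ [s [s0 _] <-]; rewrite lee_fin. Qed.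

Lemma diam_le (T : Type) (d : T -> T -> R) U (m : \bar R) :
  (forall x y, U x -> U y -> (d x y)%:E <= m) -> diam d U <= m.
Proof. by move=> H; apply: ge_ereal_sup => _ [[x y] [/= Ux Uy] <-]; exact: H. Qed.

Lemma le_diam (T : Type) (d : T -> T -> R) U x y :
  U x -> U y -> (d x y)%:E <= diam d U.
Proof. by move=> Ux Uy; apply: ereal_sup_ubound; exists (x, y). Qed.

(** Hoelder maps are replaced by relations: every point of [B] is related to a point
of [A], and no choice of this point is made. *)
Section holder.
Context (T T' : Type) (d : T -> T -> R) (d' : T' -> T' -> R).
Variables (A : set T) (B : set T') (rel : T -> T' -> Prop) (s C : R).
Hypothesis d_ge0 : forall x y, (0 <= d x y)%R.
Hypothesis d'_ge0 : forall x y, (0 <= d' x y)%R.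
Hypothesis s_gt0 : (0 < s)%R.
Hypothesis C_gt0 : (0 < C)%R.
Hypothesis rel_onto : forall y, B y -> exists2 x, A x & rel x y.
Hypothesis holder : forall x y x' y', rel x y -> rel x' y' ->
  (d' y y' <= C * d x x' `^ s)%R.

Let trace (U : set T) : set T' := [set y | exists2 x, U x & rel x y].

Lemma diam_trace U e : diam d U <= e%:E -> diam d' (trace U) <= (C * e `^ s)%:E.
Proof.
move=> Ue; apply: diam_le => y y' [x Ux xy] [x' Ux' xy']; rewrite lee_fin.
apply: le_trans (holder xy xy') _; rewrite ler_pM2l//.
have de : (d x x' <= e)%R by rewrite -lee_fin (le_trans (le_diam d Ux Ux')).
by rewrite ge0_ler_powR ?(ltW s_gt0)// nnegrE// (le_trans _ de).
Qed.

Lemma diam_pow_trace t U e : (0 <= t)%R -> diam d U <= e%:E ->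
  diam_pow d' (t / s) (trace U) <= (C `^ (t / s))%:E * diam_pow d t U.
Proof.
move=> t0 Ue; rewrite {1}/diam_pow; case: ifPn => [_|].
  by rewrite mule_ge0 ?lee_fin ?powR_ge0 ?diam_pow_ge0.
move=> /set0P[y [x Ux xy]]; rewrite /diam_pow ifF; last first.
  by apply/negbTE/set0P; exists x.
have U0 : 0 <= diam d U by rewrite (le_trans _ (le_diam d Ux Ux))// lee_fin.
case E: (diam d U) U0 Ue => [m| |]//; rewrite !lee_fin => m0 me.
have V0 : 0 <= diam d' (trace U).
  rewrite (@le_trans _ _ (d' y y)%:E)//; first by rewrite lee_fin.
  by apply: le_diam; exists x.
have mV := @diam_trace U m; rewrite E lexx in mV.
case: (diam d' (trace U)) V0 (mV isT) => [z| |]//; rewrite !lee_fin => z0 zm.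
have ts : (0 <= t / s)%R by rewrite divr_ge0// ltW.
have -> : (C `^ (t / s) * m `^ t = (C * m `^ s) `^ (t / s))%R.
  by rewrite powRM ?powR_ge0 ?(ltW C_gt0)// -powRrM [(s * _)%R]mulrC divfK ?gt_eqF.
by rewrite ge0_ler_powR// nnegrE// mulr_ge0 ?powR_ge0// ltW.
Qed.

(** A cover of [A] is carried to the cover of [B] by the sets of points related to
its members; the diameters to the power t/s are then bounded by a constant times
the original diameters to the power t. *)
Lemma hausdorff_measure_holder t : (0 <= t)%R ->
  hausdorff_measure d t A = 0 -> hausdorff_measure d' (t / s) B = 0.
Proof.
move=> t0 /hausdorff_measure_eq0 A0; apply/hausdorff_measure_eq0 => e e0.
apply/lee_addgt0Pr => h h0; rewrite add0e.
(* Sets of diameter at most [e'] are carried to sets of diameter at most [e]. *)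
pose e' : R := ((e / C) `^ s^-1)%R.
have e'0 : (0 < e')%R by rewrite powR_gt0// divr_gt0.
have Ce : (C * e' `^ s = e)%R.
  by rewrite -powRrM mulVf ?gt_eqF// powRr1 ?divr_ge0 ?ltW// mulrCA divff ?mulr1 ?gt_eqF.
have K0 : (0 < C `^ (t / s))%R by rewrite powR_gt0.
have [_ [U [AU Ue] <-] Uh] : exists2 y, [set (\sum_(0 <= i <oo) diam_pow d t (U i))%E | U in
    [set U : nat -> set T | A `<=` \bigcup_i U i /\ forall i, (diam d (U i) <= e'%:E)%E]] y &
    y < (h / C `^ (t / s))%:E.
  apply: ereal_inf_lt; apply: (le_lt_trans (A0 _ e'0)).
  by rewrite lte_fin divr_gt0.
apply: (@le_trans _ _ (\sum_(0 <= i <oo) diam_pow d' (t / s) (trace (U i)))).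
  apply: ereal_inf_lbound; exists (fun i => trace (U i)) => //; split.
    move=> y /rel_onto[x /AU[i _ Ui] xy]; exists i => //; by exists x.
  by move=> i; rewrite -Ce; exact: diam_trace.
apply: (@le_trans _ _ (\sum_(0 <= i <oo) (C `^ (t / s))%:E * diam_pow d t (U i))).
  apply: lee_nneseries => [i _ _|i _]; first exact: diam_pow_ge0.
  exact: diam_pow_trace t0 (Ue i).
rewrite nneseriesZl; last by move=> i _; exact: diam_pow_ge0.
by rewrite -lee_pdivlMl// -EFinM mulrC ltW.
Qed.

Lemma Hdim_holder : s%:E * Hdim d' B <= Hdim d A.
Proof.
apply: le_ereal_inf_tmp => _ [t [t0 tA] <-].
rewrite -lee_pdivlMl// -EFinM mulrC; apply: ereal_inf_lbound; exists (t / s)%R => //.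
by split; [rewrite divr_ge0// ltW|exact: hausdorff_measure_holder].
Qed.

End holder.

Lemma ereal_cvg_ratio (h : nat -> \bar R) (h0 : \bar R) : 0 <= h0 -> (forall k, 0 <= h k) ->
  (forall s : R, (0 < s < 1)%R ->
     \forall k \near \oo, s%:E * h k <= h0 /\ s%:E * h0 <= h k) ->
  h @ \oo --> h0.
Proof.
move=> h00 hk0 H; case: h0 h00 H => [x x0 H| _ H|//]; last first.
  have half : (0 < (2^-1 : R) < 1)%R by apply/andP; split; lra.
  apply/cvgeyPge => A; apply: filterS (H _ half) => k [_].
  by rewrite gt0_muley ?lte_fin ?invr_gt0//; case: (h k) => // _; rewrite leey.
rewrite lee_fin in x0.
have fin (s : R) k : (0 < s)%R -> s%:E * h k <= x%:E -> h k \is a fin_num.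
  move=> s0; have := hk0 k; case: (h k) => //= _.
  by rewrite gt0_muley ?lte_fin.
apply/fine_cvgP; split.
  have half : (0 < (2^-1 : R) < 1)%R by apply/andP; split; lra.
  by apply: filterS (H _ half) => k [+ _]; apply: fin; rewrite invr_gt0.
apply/cvgrPdist_le => e e0.
(* Then x / s <= x + e and x - e <= s * x. *)
pose s : R := ((x + 1) / (x + 1 + e))%R.
have xe : (0 < x + 1 + e)%R by lra.
have s01 : (0 < s < 1)%R.
  by rewrite divr_gt0//=; [rewrite ltr_pdivrMr//; lra|lra].
apply: filterS (H _ s01) => k [Hl Hr] /=.
have /andP[s0 _] := s01.
have := fin _ _ s0 Hl => /fineK hE; rewrite -hE -!EFinM !lee_fin in Hl Hr.
set y := fine (h k) in Hl Hr *.
have Hl' : ((x + 1) * y <= x * (x + 1 + e))%R.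
  by move: Hl; rewrite /s mulrAC ler_pdivrMr.
have Hr' : ((x + 1) * x <= y * (x + 1 + e))%R.
  by move: Hr; rewrite /s mulrAC ler_pdivrMr.
rewrite ler_norml; apply/andP; split; nra.
Qed.

Lemma hausdorff_dist_ge0 (T : Type) (d : T -> T -> R) A B : 0 <= hausdorff_dist d A B.
Proof. by apply: le_ereal_inf_tmp => _ [e [e0 _ _] <-]; rewrite lee_fin ltW. Qed.

Lemma hausdorff_dist_cvg0 (T : Type) (d : T -> T -> R) (A : nat -> set T) B :
  (forall e, (0 < e)%R -> \forall k \near \oo,
     A k `<=` thickening d e B /\ B `<=` thickening d e (A k)) ->
  hausdorff_dist d (A k) B @[k --> \oo] --> 0.
Proof.
move=> H; have le e : (0 < e)%R -> \forall k \near \oo, hausdorff_dist d (A k) B <= e%:E.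
  move=> e0; apply: filterS (H e e0) => k [AB BA].
  by apply: ereal_inf_lbound; exists e.
apply/fine_cvgP; split.
  apply: filterS (le 1%R ltr01) => k; have := hausdorff_dist_ge0 d (A k) B.
  by case: (hausdorff_dist _ _ _).
apply/cvgrPdist_le => e e0; apply: filterS (le e e0) => k /=.
have := hausdorff_dist_ge0 d (A k) B.
case: (hausdorff_dist _ _ _) => [x||]//=; rewrite !lee_fin => x0 xe.
by rewrite sub0r normrN ger0_norm.
Qed.

End hausdorff_dimension.

(** * Convergence of limit sets *)

(** The graph of the equivariant map between limit sets: two boundary points that
are approached along the same sequence of group elements. As a relation it is
inverted by exchanging the two representations. *)
Definition boundary_correspondence (R : realType) (X : metricType R) (o : X) (r : nat)
    (rho rho' : representation r X) (xi zeta : boundary o) : Prop :=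
  exists2 g : nat -> free_group r,
    bd_class xi (fun n => rho (g n) o) & bd_class zeta (fun n => rho' (g n) o).

Section correspondence.
Context {R : realType} {X : metricType R} (o : X) {r : nat}.
Implicit Types (rho : representation r X).

Lemma gromov_seq_transfer rho rho' (s C : R) (g : nat -> free_group r) : 0 < s ->
  (forall g h : free_group r,
     s * gromov o (rho g o) (rho h o) - C <= gromov o (rho' g o) (rho' h o)) ->
  gromov_seq o (fun n => rho (g n) o) -> gromov_seq o (fun n => rho' (g n) o).
Proof.
move=> s0 H /gromov_seqP G; apply/gromov_seqP => A.
have [N NP] := G ((A + C) / s); exists N => n m Nn Nm.
apply: le_trans (H (g n) (g m)); rewrite lerBrDr mulrC -ler_pdivrMr//.
exact: NP.
Qed.

Lemma correspondence_onto rho rho' (s C : R) : 0 < s ->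
  (forall g h : free_group r,
     s * gromov o (rho g o) (rho h o) - C <= gromov o (rho' g o) (rho' h o)) ->
  forall xi, limit_set o rho xi -> exists2 zeta, limit_set o rho' zeta &
    boundary_correspondence rho rho' xi zeta.
Proof.
move=> s0 H xi [g xig].
have [zeta zg] := boundary_exists (gromov_seq_transfer s0 H (boundary_seq xig)).
by exists zeta; exists g.
Qed.

Lemma correspondence_sym rho rho' (xi zeta : boundary o) :
  boundary_correspondence rho rho' xi zeta -> boundary_correspondence rho' rho zeta xi.
Proof. by move=> [g ? ?]; exists g. Qed.

(** The first comparison of Gromov products makes the correspondence Hoelder, the
second one makes it onto. *)
Lemma Hdim_limit_set rho rho' (s C : R) : CAT_m1 X -> 0 < s ->
  (forall g h : free_group r,
     s * gromov o (rho g o) (rho h o) - C <= gromov o (rho' g o) (rho' h o)) ->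
  (forall g h : free_group r,
     s * gromov o (rho' g o) (rho' h o) - C <= gromov o (rho g o) (rho h o)) ->
  (s%:E * Hdim (visual_dist o) (limit_set o rho') <= Hdim (visual_dist o) (limit_set o rho))%E.
Proof.
move=> Xcat s0 H H'; have tri := CAT_visual_triangle o Xcat.
apply: (@Hdim_holder _ _ _ _ _ _ _ (@boundary_correspondence R X o r rho rho') s (expR C)) => //.
- by move=> *; exact: visual_ge0.
- by move=> *; exact: visual_ge0.
- exact: expR_gt0.
- move=> zeta /(correspondence_onto s0 H')[xi xiL Hxi].
  by exists xi => //; exact: correspondence_sym.
move=> xi zeta xi' zeta' [g xig zg] [h xih zh].
exact: (visual_holder tri s0 xig xih zg zh (fun n m => H (g n) (h m))).
Qed.

End correspondence.

Theorem theorem1p7 (R : realType) (r : nat) (X : completeMetricType R) (o : X)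
    (rho : nat -> representation r X) (rho_oo : representation r X) :
  (2 <= r)%N ->
  CAT_m1 X ->
  schottky o rho_oo ->
  (forall g : free_group r, rho k g o @[k --> \oo] --> rho_oo g o) ->
  (hausdorff_dist (visual_dist o) (limit_set o (rho k)) (limit_set o rho_oo)
     @[k --> \oo] --> 0%E) /\
  (Hdim (visual_dist o) (limit_set o (rho k)) @[k --> \oo]
     --> Hdim (visual_dist o) (limit_set o rho_oo)).
Proof.
move=> _ Xcat sch cvg_orbit.
have tri := CAT_visual_triangle o Xcat.
have hyp := CAT_four_point Xcat.
have dl0 : 0 <= ln 2 :> R by rewrite ln_ge0// ler1n.
(* The exponent of both comparisons of Gromov products may be taken to be the
   same s, since 1 / (1 + e) >= 1 - e. *)
have close (s : R) : 0 < s < 1 -> exists C, \forall k \near \oo,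
    (forall g h : free_group r,
     s * gromov o (rho k g o) (rho k h o) - C <= gromov o (rho_oo g o) (rho_oo h o)) /\
    (forall g h : free_group r,
     s * gromov o (rho_oo g o) (rho_oo h o) - C <= gromov o (rho k g o) (rho k h o)).
  move=> /andP[s0 s1]; have e0 : 0 < 1 - s by lra.
  have [C HC] := gromov_orbit_close cvg_orbit dl0 hyp sch e0.
  exists C; apply: filterS HC => k HC.
  have C0 : 0 <= C.
    have := HC 1%g 1%g; rewrite !representation1 gromovxx mdistxx subrr normr0 mulr0 add0r.
    by [].
  split=> g h; have := HC g h; rewrite ler_norml => /andP[].
    set a := gromov _ _ _; set b := gromov _ _ _ => ? ?.
    have b0 : 0 <= b by exact: gromov_ge0.
    have a0 : 0 <= a by exact: gromov_ge0.
    nra.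
  lra.
have half : 0 < (2^-1 : R) < 1 by apply/andP; split; lra.
split.
  apply: hausdorff_dist_cvg0 => e e0.
  have e2 : 0 < e / 2 by rewrite divr_gt0.
  have [L HL] := gromov_orbit_large cvg_orbit dl0 hyp sch (- ln (e / 2)).
  have [B HB] := schottky_word_length sch L.
  have [C HC] := close _ half.
  have near_pts k : (forall g : free_group r, (L <= word_length g)%N ->
        - ln (e / 2) <= gromov o (rho k g o) (rho_oo g o)) ->
      forall xi zeta : boundary o, boundary_correspondence (rho k) rho_oo xi zeta ->
      visual_dist o xi zeta < e /\ visual_dist o zeta xi < e.
    move=> Hk xi zeta [g xig zg].
    have [N HN] := (gromov_seqP _ _).1 (boundary_seq zg) B.
    have len n : (N <= n)%N -> - ln (e / 2) <= gromov o (rho k (g n) o) (rho_oo (g n) o).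
      move=> Nn; apply/Hk/HB; apply: le_trans (HN n n Nn Nn) _.
      exact: gromov_lel.
    have d1 : visual_dist o xi zeta <= e / 2.
      by apply: (visual_le tri xig zg e2); exists N.
    have d2 : visual_dist o zeta xi <= e / 2.
      by apply: (visual_le tri zg xig e2); exists N => n Nn; rewrite gromov_sym len.
    by split; lra.
  near=> k.
  have Hk : forall g : free_group r, (L <= word_length g)%N ->
        - ln (e / 2) <= gromov o (rho k g o) (rho_oo g o) by near: k.
  have [Ck Coo] : (forall g h : free_group r,
     2^-1 * gromov o (rho k g o) (rho k h o) - C <= gromov o (rho_oo g o) (rho_oo h o)) /\
    (forall g h : free_group r,
     2^-1 * gromov o (rho_oo g o) (rho_oo h o) - C <= gromov o (rho k g o) (rho k h o)) by near: k.
  have half0 : 0 < (2^-1 : R) by case/andP: half.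
  split=> [xi /(correspondence_onto half0 Ck)[zeta zL c]|
      zeta /(correspondence_onto half0 Coo)[xi xL c]].
    by exists zeta => //; case: (near_pts _ Hk _ _ c).
  by exists xi => //; case: (near_pts _ Hk _ _ (correspondence_sym c)).
apply: ereal_cvg_ratio; [exact: Hdim_ge0|by move=> k; exact: Hdim_ge0|].
move=> s s01; have [C HC] := close s s01; have /andP[s0 _] := s01.
apply: filterS HC => k [Ck Coo]; split; exact: (Hdim_limit_set Xcat s0 _ _).
Unshelve. all: by end_near. Qed.
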